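(* Let $G$ be an antipodal distance-regular graph of diameter $3$ with valency $k$ and distinct adjacency eigenvalues $k>\theta_1>\theta_2>\theta_3$. If, for some real $q\neq0$, $G$ has exactly $2$ distinct $q$-distance eigenvalues, then $G$ is one of the following graphs: (1) the Johnson graph $J(6,3)$, with intersection array $\{9,4,1;1,4,9\}$, where $R_q(k)=R_q(3)=R_q(-1)=3$ for $q=-\frac12$; (2) the distance-$2$ graph of the halved $6$-cube, with intersection array $\{15,8,1;1,8,15\}$, where $R_q(k)=R_q(3)=R_q(-1)=3$ for $q=-\frac12$; (3) the distance-$2$ graph of the Gosset graph, with intersection array $\{27,16,1;1,16,27\}$, where $R_q(k)=R_q(3)=R_q(-1)=3$ for $q=-\frac12$; (4) a graph with intersection array $\{35,18,1;1,18,35\}$, where $R_q(k)=-28=R_q(\theta_3)$ and $R_q(\theta_1)=8=R_q(-1)$ for $q=-\frac13$.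
   Context: Graphs are finite, undirected and simple. A connected graph $G$ of diameter $D$ is distance-regular if there are numbers $a_i,b_i,c_i$ ($0\le i\le D$) such that for all vertices $x,y$ with $d(x,y)=i$, the number of neighbours of $y$ at distance $i-1$, $i$, $i+1$ from $x$ is $c_i$, $a_i$, $b_i$ respectively; $k=b_0$ is the valency, and $\{b_0,\dots,b_{D-1};c_1=1,c_2,\dots,c_D\}$ is the intersection array. $G$ is antipodal if $d(u,v)=d(u,w)=D$ implies $d(v,w)=D$ or $v=w$. For real $q\ne0$, the $q$-distance matrix $\mathbb{D}_q(G)$ has entries $1+\frac1q+\cdots+\frac1{q^{d-1}}$ at $(x,y)$ with $d(x,y)=d\ge1$ and zero diagonal; its eigenvalues are the $q$-distance eigenvalues of $G$. For distance-regular $G$ with adjacency matrix $A$, $\mathbb{D}_q(G)=R_q(A)$ for a polynomial $R_q$ of degree at most $D$, so that $R_q(\theta)$ is the eigenvalue of $\mathbb{D}_q(G)$ corresponding to the adjacency eigenvalue $\theta$. The distance-$2$ graph of $G$ has vertex set $V(G)$, two vertices being adjacent when they are at distance $2$ in $G$. The halved $6$-cube has as vertices the binary words of length $6$ of even weight, adjacent when they differ in exactly two positions; the Gosset graph is the (unique) distance-regular graph with intersection array $\{27,10,1;1,10,27\}$, on $56$ vertices. *)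

(* Defs.v *)
From HB Require Import structures.
From mathcomp Require Import all_boot all_order all_algebra reals.
Set Implicit Arguments.
Unset Strict Implicit.
Unset Printing Implicit Defensive.
Import Order.TTheory GRing.Theory Num.Theory.
Local Open Scope ring_scope.

Record sgraph := SGraph {
  vertex :> finType;
  adj : rel vertex;
  adj_sym : symmetric adj;
  adj_irr : irreflexive adj }.

Definition isomorphic (G H : sgraph) : Prop :=
  exists2 f : G -> H, bijective f & forall x y, adj (f x) (f y) = adj x y.

Section Distance.
Variable G : sgraph.
Implicit Types x y z u v w : G.

Definition walk n x y : bool :=
  [exists p : n.-tuple G, path (@adj G) x p && (last x p == y)].

(* The distance is less than #|G| when x and y are connected, and it is set to
   #|G| when they are not. *)
Definition gdist x y : nat := find (fun n => walk n x y) (iota 0 #|G|).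

Definition connected : Prop := forall x y, connect (@adj G) x y.

Definition diameter : nat := \max_(x : G) \max_(y : G) gdist x y.

(* At distance i = 0 the first equation forces c 0 = 0, and the third one says
   that b 0 is the valency. *)
Definition intersection_numbers (a b c : nat -> nat) : Prop :=
  forall x y, let i := gdist x y in
  [/\ #|[set z | adj y z & (gdist x z).+1 == i]| = c i,
      #|[set z | adj y z & gdist x z == i]| = a i &
      #|[set z | adj y z & gdist x z == i.+1]| = b i].

Definition distance_regular (a b c : nat -> nat) : Prop :=
  connected /\ intersection_numbers a b c.

Definition has_intersection_array (bs cs : seq nat) : Prop :=
  exists a b c, [/\ distance_regular a b c,
    bs = [seq b i | i <- iota 0 diameter] &
    cs = [seq c i | i <- iota 1 diameter]].

Definition antipodal : Prop :=
  forall u v w, gdist u v = diameter -> gdist u w = diameter ->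
    gdist v w = diameter \/ v = w.

Lemma walk_sym n x y : walk n x y = walk n y x.
Proof.
suff W u v : walk n u v -> walk n v u by apply/idP/idP; apply: W.
case/existsP=> p /andP[pth /eqP <-]; apply/existsP.
have sz : size (rev (belast u p)) == n by rewrite size_rev size_belast size_tuple.
exists (Tuple sz) => /=; rewrite rev_path; apply/andP; split.
  by apply: sub_path pth => s t; rewrite adj_sym.
by case: {+}(tval p) => //= z s; rewrite rev_cons last_rcons.
Qed.

Lemma gdist_sym x y : gdist x y = gdist y x.
Proof. by apply: eq_find => n; apply: walk_sym. Qed.

Lemma gdistxx x : gdist x x = 0%N.
Proof.
rewrite /gdist; have: (0 < #|G|)%N by apply/card_gt0P; exists x.
case: #|G| => //= n _; suff -> : walk 0 x x by [].
by apply/existsP; exists [tuple]; rewrite /= eqxx.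
Qed.

Definition dist2_adj : rel G := [rel x y | gdist x y == 2%N].

Lemma dist2_adj_sym : symmetric dist2_adj.
Proof. by move=> x y; rewrite /dist2_adj /= gdist_sym. Qed.

Lemma dist2_adj_irr : irreflexive dist2_adj.
Proof. by move=> x; rewrite /dist2_adj /= gdistxx. Qed.

Definition distance2_graph : sgraph := SGraph dist2_adj_sym dist2_adj_irr.

End Distance.

Section Matrices.
Variables (R : realType) (G : sgraph).

Definition adjacency_mx : 'M[R]_#|G| :=
  \matrix_(i, j) (adj (enum_val i) (enum_val j))%:R.

Definition qdistance_mx (q : R) : 'M[R]_#|G| :=
  \matrix_(i, j) \sum_(l < gdist (enum_val i) (enum_val j)) q ^- l.

(* p(A); horner_mx is only available for matrices whose order is syntactically
   a successor. *)
Definition poly_mx n (p : {poly R}) (A : 'M[R]_n) : 'M[R]_n :=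
  \sum_(i < size p) p`_i *: A ^+ i.

(* For a distance-regular graph there is exactly one such polynomial, because
   the adjacency matrix then has diameter + 1 distinct eigenvalues. *)
Definition qdistance_poly (q : R) (p : {poly R}) : Prop :=
  (size p <= (diameter G).+1)%N /\ qdistance_mx q = poly_mx p adjacency_mx.

Definition distinct_eigenvalues n (M : 'M[R]_n) (s : seq R) : Prop :=
  uniq s /\ forall x, eigenvalue M x = (x \in s).

End Matrices.

Section Johnson.
Variables n m : nat.

Definition johnson_vertex := {A : {set 'I_n} | #|A| == m}.

Definition johnson_adj : rel johnson_vertex :=
  [rel A B : johnson_vertex | #|val A :&: val B|.+1 == m].

Lemma johnson_adj_sym : symmetric johnson_adj.
Proof. by move=> A B; rewrite /johnson_adj /= setIC. Qed.

Lemma johnson_adj_irr : irreflexive johnson_adj.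
Proof.
by move=> A; rewrite /johnson_adj /= setIid (eqP (valP A)) gtn_eqF.
Qed.

Definition johnson : sgraph := SGraph johnson_adj_sym johnson_adj_irr.

End Johnson.

Section HalvedCube.
Variable n : nat.

Definition even_word := {w : {ffun 'I_n -> bool} | ~~ odd #|[set i | w i]|}.

Definition halved_cube_adj : rel even_word :=
  [rel v w : even_word | #|[set i | val v i != val w i]| == 2%N].

Lemma halved_cube_adj_sym : symmetric halved_cube_adj.
Proof.
move=> v w; rewrite /halved_cube_adj /=; congr (_ == _).
by apply: eq_card => i; rewrite !inE eq_sym.
Qed.

Lemma halved_cube_adj_irr : irreflexive halved_cube_adj.
Proof.
by move=> v; rewrite /halved_cube_adj /= (_ : [set _ | _] = set0) ?cards0 //;
  apply/setP => i; rewrite !inE eqxx.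
Qed.

Definition halved_cube : sgraph :=
  SGraph halved_cube_adj_sym halved_cube_adj_irr.

End HalvedCube.

(* The Gosset graph is specified, up to isomorphism, as the unique graph with
   its intersection array; the last clause is the uniqueness. *)
Definition is_gosset (H : sgraph) : Prop :=
  [/\ has_intersection_array H [:: 27; 10; 1]%N [:: 1; 10; 27]%N,
      #|H| = 56%N &
      forall H' : sgraph,
        has_intersection_array H' [:: 27; 10; 1]%N [:: 1; 10; 27]%N ->
        isomorphic H' H].

(* Main.v *)
From HB Require Import structures.
Require Import Defs.
From mathcomp Require Import all_boot all_order all_algebra reals.
From mathcomp Require Import zify ring lra.
Set Implicit Arguments.
Unset Strict Implicit.
Unset Printing Implicit Defensive.
Import Order.TTheory GRing.Theory Num.Theory.

(** Let e + 1 be the size of the antipodal classes and u = 1 / q. Antipodality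
   gives b2 = 1, c3 = k and b1 = e c2. Hence the distance matrices satisfy
   A^2 = k + a1 A + c2 A2, A3 A = A2 and 1 + A + A2 + A3 = J. On the complement of
   the all-ones vector this leaves for A the eigenvalue -1 and the two roots of
   x^2 = (a1 - c2) x + k, which lie on both sides of -1. So theta2 = -1 and
   theta1 theta3 = - k, and the q-distance matrix has an explicit eigenvalue at
   each of k, theta1, -1 and theta3 (adjacency_spectrum, qdistance_eigenvalue).

   The values at theta1 and theta3 differ, so each of those at k and -1 equals one
   of them. The value at -1 is the one at theta1, since otherwise u is positive
   and the value at k is too large; this gives (e + 1) u = - (theta1 + 1).
   If the value at k is also the one at theta1, then (e + 1)^2 = e (theta1 + 1).
   As theta1 is an algebraic integer, e = 1, theta1 = 3, u = -2 and
   k = 3 (a1 - 1) (val_k_theta1).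
   If it is the one at theta3, then theta1 satisfies a linear equation besides the
   quadratic one, so it is an integer, and only the arrays {35,18,1;1,18,35},
   {15,8,1;1,4,15} and {35,27,1;1,9,35} remain (val_k_theta3). The first is the
   last case of the theorem. In the third the subgraph induced on the neighbours
   of a vertex would have 35 vertices and valency 7. In the second the eigenvalue
   5 has multiplicity 12, less than the 15 neighbours of a vertex, which makes
   -7/3 an eigenvalue of the subgraph induced on them; this is not an algebraic
   integer (valency_a1_even, array_15_8_1_excluded).

   There remain the graphs with e = 1 and k = 3 (a1 - 1). These are Taylor graphs
   in which every triangle lies in exactly one complete graph on four vertices, so
   that the neighbours of a vertex are the points of a generalized quadrangle
   with three points on each line. In it two nonadjacent points x and y with their
   t common neighbours generate, by taking third points on lines, configurations
   in which all adjacencies are forced: adjacency to the third point of a line is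
   decided by adjacency to the other two. It follows that t is 2, 3 or 5, and that
   the whole graph is determined by t = a1 / 2 (point_adj, taylor_framing). Explicit
   coordinates identify the first two graphs. The distance-2 graph of a Taylor
   graph is a Taylor graph with k - 1 - a1 in place of a1, and the operation is an
   involution. It turns the third graph into one with the array of the Gosset
   graph and proves the uniqueness of the latter (distance2_is_gosset). *)

(** * Distances *)

Section Distances.
Variable G : sgraph.
Implicit Types x y z : G.

Lemma walk0 x y : walk 0 x y = (x == y).
Proof.
apply/existsP/idP => [[p]|/eqP->]; first by rewrite tuple0.
by exists [tuple]; rewrite /= eqxx.
Qed.

Lemma walkS n x y : walk n.+1 x y = [exists z, adj x z && walk n z y].
Proof.
apply/existsP/existsP.
  case=> p; case/tupleP: p => z p /= /andP[/andP[xz pz] pl].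
  by exists z; rewrite xz /=; apply/existsP; exists p; rewrite pz.
case=> z /andP[xz /existsP[p /andP[pz pl]]].
by exists [tuple of z :: p]; rewrite /= xz pz.
Qed.

Lemma walk1 x y : walk 1 x y = adj x y.
Proof.
rewrite walkS; apply/existsP/idP => [[z]|xy]; last first.
  by exists y; rewrite xy walk0 eqxx.
by rewrite walk0 => /andP[xz /eqP <-].
Qed.

Lemma walk_adj n x y z : walk n x y -> adj y z -> walk n.+1 x z.
Proof.
move=> w yz; rewrite walk_sym walkS; apply/existsP; exists y.
by rewrite adj_sym yz walk_sym.
Qed.

Lemma gdist_le n x y : walk n x y -> gdist x y <= n.
Proof.
move=> w; have [n_lt|le_n] := ltnP n #|G|; last first.
  by apply: leq_trans le_n; rewrite -[X in _ <= X](size_iota 0); apply: find_size.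
rewrite leqNgt; apply/negP => lt_n; have := before_find 0 lt_n.
by rewrite nth_iota // add0n w.
Qed.

(** Without connectedness: the bound on #|G| excludes the default value of the
   distance of unconnected vertices. *)
Lemma gdist_eq2 x y : 2 < #|G| ->
  (gdist x y == 2) = [&& x != y, ~~ adj x y & [exists z, adj x z && adj z y]].
Proof.
move=> lt2; have w2 : walk 2 x y = [exists z, adj x z && adj z y].
  by rewrite walkS; apply: eq_existsb => z; rewrite walk1.
rewrite -walk0 -walk1 -w2 /gdist.
by case: #|G| lt2 => [|[|[|m]]] //= _; do 3!case: ifP => //=.
Qed.

Hypothesis conn : connected G.

Lemma walk_gdist x y : walk (gdist x y) x y.
Proof.
have : has (fun n => walk n x y) (iota 0 #|G|).
  have /connectP[p pth ->] := conn x y.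
  case/shortenP: pth => p' pth uq _; apply/hasP; exists (size p').
    by have /= sz := card_uniqP uq; rewrite mem_iota /= add0n -sz max_card.
  by apply/existsP; exists (in_tuple p'); rewrite /= pth eqxx.
move=> h; have := nth_find 0 h; rewrite nth_iota //.
by move: h; rewrite has_find size_iota.
Qed.

Lemma gdist_eq0 x y : (gdist x y == 0) = (x == y).
Proof.
apply/eqP/eqP => [d|->]; last exact: gdistxx.
by apply/eqP; rewrite -walk0 -d walk_gdist.
Qed.

Lemma gdist_eq1 x y : (gdist x y == 1) = adj x y.
Proof.
apply/eqP/idP => [d|xy]; first by rewrite -walk1 -d walk_gdist.
apply/eqP; rewrite eqn_leq gdist_le ?walk1 //= lt0n gdist_eq0.
by apply: contraTneq xy => ->; rewrite adj_irr.
Qed.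

Lemma gdist_adj x y z : adj y z -> gdist x z <= (gdist x y).+1.
Proof. by move=> yz; apply/gdist_le/walk_adj/yz/walk_gdist. Qed.

Lemma gdist_pred x y i : gdist x y = i.+1 -> exists2 z, adj y z & gdist x z = i.
Proof.
rewrite gdist_sym => d; have := walk_gdist y x; rewrite d walkS.
case/existsP => z /andP[yz /gdist_le le_i]; exists z => //; apply/eqP.
rewrite eqn_leq gdist_sym le_i /= -ltnS -d.
by rewrite gdist_sym [gdist z x]gdist_sym; apply: gdist_adj; rewrite adj_sym.
Qed.

Lemma gdist_le_diameter x y : gdist x y <= diameter G.
Proof.
apply: leq_trans (leq_bigmax (F := fun x : G => \max_y gdist x y) x).
exact: (leq_bigmax (F := gdist x)).
Qed.

Lemma diameter_attained : 0 < #|G| -> exists x y : G, gdist x y = diameter G.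
Proof.
move=> G0; rewrite /diameter.
have [x ->] := bigop.eq_bigmax (fun x : G => \max_y gdist x y) G0.
by have [y ->] := bigop.eq_bigmax (gdist x) G0; exists x, y.
Qed.

End Distances.

Lemma walk_iso (G H : sgraph) (f : G -> H) n x y : bijective f ->
  (forall x y, adj (f x) (f y) = adj x y) -> walk n (f x) (f y) = walk n x y.
Proof.
move=> bf fE; elim: n x y => [|n IH] x y.
  by rewrite !walk0 (inj_eq (bij_inj bf)).
rewrite !walkS; apply/existsP/existsP => -[z]; last first.
  by exists (f z); rewrite fE IH.
have [g _ gK] := bf; rewrite -[z]gK fE IH => zP.
by exists (g z).
Qed.

Lemma gdist_iso (G H : sgraph) (f : G -> H) x y : bijective f ->
  (forall x y, adj (f x) (f y) = adj x y) -> gdist (f x) (f y) = gdist x y.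
Proof.
move=> bf fE; rewrite /gdist (bij_eq_card bf).
by apply: eq_find => n; apply: walk_iso.
Qed.

Lemma isomorphic_sym (G H : sgraph) : isomorphic G H -> isomorphic H G.
Proof.
case=> f [g fK gK] fE; exists g; first by exists f.
by move=> x y; rewrite -fE !gK.
Qed.

Lemma isomorphic_trans (G H K : sgraph) :
  isomorphic G H -> isomorphic H K -> isomorphic G K.
Proof.
case=> f bf fE [g bg gE]; exists (g \o f); first exact: bij_comp.
by move=> x y /=; rewrite gE fE.
Qed.

Lemma isomorphic_distance2 (G H : sgraph) :
  isomorphic G H -> isomorphic (distance2_graph G) (distance2_graph H).
Proof.
case=> f bf fE; exists (f : distance2_graph G -> distance2_graph H).
  exact: bf.
move=> x y /=; by rewrite /dist2_adj /= (@gdist_iso G H f x y bf fE).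
Qed.

(** * Taylor graphs *)

(** The distance-regular antipodal double covers of complete graphs, given by
   their antipodal map s: one of x and s x is adjacent to any vertex outside
   {x, s x}, so that valency and lambda determine all intersection numbers. *)
Record taylor (G : sgraph) (s : G -> G) (k a1 : nat) : Prop := Taylor {
  antipodeK : involutive s;
  antipode_neq (x : G) : s x != x;
  antipode_nadj (x : G) : ~~ adj x (s x);
  antipode_adj (x y : G) : y != x -> y != s x -> adj (s x) y = ~~ adj x y;
  taylor_valency (x : G) : #|[set y | adj x y]| = k;
  taylor_lambda (x y : G) : adj x y -> #|[set z | adj x z & adj y z]| = a1 }.

Section TaylorGraphs.
Variables (G : sgraph) (s : G -> G) (k a1 : nat).
Hypothesis tG : taylor s k a1.
Implicit Types x y z : G.

Let sK := antipodeK tG.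
Let s_neq := antipode_neq tG.
Let s_nadj := antipode_nadj tG.

Lemma adj_neq x y : adj x y -> x != y.
Proof. by apply: contraTneq => ->; rewrite adj_irr. Qed.

Lemma adj_antipode x y : adj (s x) (s y) = adj x y.
Proof.
have [->|neq] := eqVneq y x; first by rewrite !adj_irr.
have [->|neqs] := eqVneq y (s x); first by rewrite sK adj_sym.
rewrite (antipode_adj tG); last 2 first.
- by apply: contra neqs => /eqP <-; rewrite sK.
- by rewrite (inj_eq (inv_inj sK)).
rewrite adj_sym (antipode_adj tG) ?negbK 1?adj_sym // 1?eq_sym //.
by apply: contra neqs => /eqP <-; rewrite sK.
Qed.

Lemma adj_antipode_r x y : y != x -> y != s x -> adj x (s y) = ~~ adj x y.
Proof.
by move=> neq neqs; rewrite -(antipode_adj tG neq neqs) -adj_antipode sK.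
Qed.

Lemma card_adj_nadj x y : adj x y ->
  #|[set z | [&& adj x z, z != y & ~~ adj y z]]| = k.-1 - a1.
Proof.
move=> xy; have := cardsID [set z | adj y z] [set z | adj x z].
rewrite (taylor_valency tG) -setIdE.
rewrite (_ : [set z in _ | _] = [set z | adj x z & adj y z]); last first.
  by apply/setP=> z; rewrite !inE.
rewrite (taylor_lambda tG xy) (cardsD1 y) !inE xy adj_irr /=.
rewrite (_ : _ :\ y = [set z | [&& adj x z, z != y & ~~ adj y z]]); last first.
  by apply/setP=> z; rewrite !inE; do !case: (_ == _); case: adj; case: adj.
by move=> <-; lia.
Qed.

(** The common neighbours of x and y are the neighbours of x that are not
   neighbours of s y, which is adjacent to x. *)
Lemma taylor_mu x y : y != x -> y != s x -> ~~ adj x y ->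
  #|[set z | adj x z & adj y z]| = k.-1 - a1.
Proof.
move=> neq neqs nxy; have xsy : adj x (s y).
  by rewrite adj_antipode_r.
rewrite -(card_adj_nadj xsy); apply: eq_card => z; rewrite !inE.
case xz: (adj x z) => //=.
have [->|zsy] := eqVneq z (s y); first by rewrite (negPf (s_nadj y)).
have zy : z != y by apply: contraTneq xz => ->.
by rewrite (antipode_adj tG zy zsy) negbK.
Qed.

Lemma card_taylor (x : G) : #|G| = (2 * k).+2.
Proof.
rewrite -cardsT (cardsD1 x) (cardsD1 (s x)) !inE s_neq /=.
set A := _ :\ _; suff -> : #|A| = (2 * k)%N by lia.
rewrite -(cardsID [set z | adj x z] A).
have <- : [set z | adj x z] = A :&: [set z | adj x z].
  apply/setP=> z; rewrite !inE andbT; case xz: (adj x z); rewrite ?andbF //.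
  rewrite andbT; apply/esym/andP; split; last by rewrite eq_sym adj_neq.
  by apply: contraTneq xz => ->.
have <- : [set z | adj (s x) z] = A :\: [set z | adj x z].
  apply/setP=> z; rewrite !inE andbT.
  have [->|zx] := eqVneq z x.
    by rewrite adj_sym (negPf (s_nadj x)) !andbF.
  have [->|zsx] := eqVneq z (s x); first by rewrite adj_irr !andbF.
  by rewrite (antipode_adj tG) //= andbT.
by rewrite !(taylor_valency tG); lia.
Qed.

Hypothesis a1_lt : a1 < k.-1.

Let walk2 x y : y != x -> y != s x -> ~~ adj x y -> walk 2 x y.
Proof.
move=> neq neqs nxy; have := taylor_mu neq neqs nxy.
have : 0 < k.-1 - a1 by rewrite subn_gt0.
move=> /[swap] <- /card_gt0P[z]; rewrite inE => /andP[xz yz].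
by apply: (walk_adj _ (y := z)); rewrite ?walk1 // adj_sym.
Qed.

Let nbr_antipode x : exists2 z, adj x z & walk 2 x (s z) /\ adj (s z) (s x).
Proof.
have : 0 < k by lia.
rewrite -(taylor_valency tG x) => /card_gt0P[z]; rewrite inE => xz.
exists z => //; split; last by rewrite adj_antipode adj_sym.
have zx : z != x by rewrite eq_sym adj_neq.
have zsx : z != s x by apply: contraTneq xz => ->.
apply: walk2; last by rewrite adj_antipode_r // xz.
  by apply: contra zsx => /eqP <-; rewrite sK.
by rewrite (inj_eq (inv_inj sK)).
Qed.

Lemma taylor_connected : connected G.
Proof.
move=> x y; suff [n] : exists n, walk n x y.
  by case/existsP=> p /andP[pth /eqP <-]; apply/connectP; exists p.
have [->|neq] := eqVneq y x; first by exists 0; rewrite walk0.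
have [xy|nxy] := boolP (adj x y); first by exists 1; rewrite walk1.
have [->|neqs] := eqVneq y (s x); last by exists 2; apply: walk2.
have [z _ [w zx]] := nbr_antipode x.
by exists 3; apply: walk_adj w zx.
Qed.

Lemma taylor_gdist x y : gdist x y =
  if y == x then 0 else if adj x y then 1 else if y == s x then 3 else 2.
Proof.
have conn := taylor_connected.
have [->|neq] := eqVneq y x; first exact: gdistxx.
have [xy|nxy] := boolP (adj x y); first by apply/eqP; rewrite gdist_eq1.
have [yE|neqs] := eqVneq y (s x); last first.
  have le2 := gdist_le (walk2 neq neqs nxy).
  have n0 : gdist x y != 0 by rewrite gdist_eq0 // eq_sym.
  have n1 : gdist x y != 1 by rewrite gdist_eq1.
  by case: gdist le2 n0 n1 => [|[|[|]]].
have d2 : gdist x y != 2.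
  apply/eqP=> /(gdist_pred conn)[z yz] /eqP; rewrite gdist_eq1 // => xz.
  have zx : z != x by rewrite eq_sym adj_neq.
  have zsx : z != s x by rewrite -yE eq_sym adj_neq.
  by move: yz; rewrite yE (antipode_adj tG) // xz.
have d0 : gdist x y != 0 by rewrite gdist_eq0 // eq_sym.
have d1 : gdist x y != 1 by rewrite gdist_eq1.
suff : gdist x y <= 3 by case: gdist d0 d1 d2 => [|[|[|[|]]]].
have [z _ [/gdist_le le2 /(gdist_adj conn x) le3]] := nbr_antipode x.
by rewrite yE; apply: leq_trans le3 _.
Qed.

Lemma taylor_diameter : G -> diameter G = 3.
Proof.
move=> x; apply/eqP; rewrite eqn_leq; apply/andP; split.
  apply/bigmax_leqP => u _; apply/bigmax_leqP => v _.
  by rewrite taylor_gdist; do !case: ifP.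
apply: leq_trans (gdist_le_diameter x (s x)).
by rewrite taylor_gdist (negPf (s_neq x)) (negPf (s_nadj x)) eqxx.
Qed.

Lemma adj_distance2 x y : adj (s := distance2_graph G) x y = adj x (s y).
Proof.
rewrite /= /dist2_adj /= taylor_gdist.
have [->|neq] := eqVneq y x; first by rewrite (negPf (s_nadj x)).
have [->|neqs] := eqVneq y (s x).
  by rewrite sK adj_irr; case: ifP.
by rewrite adj_antipode_r //; case: adj.
Qed.

(** The neighbours of x in the distance-2 graph are those of s x in G, so common
   neighbours are counted by taylor_mu. *)
Lemma taylor_distance2 : @taylor (distance2_graph G) s k (k.-1 - a1).
Proof.
have nbrE x y : adj x (s y) = adj (s x) y by rewrite -adj_antipode sK.
split=> // [x|x y neq neqs|x|x y]; rewrite ?adj_distance2.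
- by rewrite sK adj_irr.
- by rewrite adj_antipode adj_antipode_r // negbK.
- rewrite -(taylor_valency tG (s x)); apply: eq_card => z.
  by rewrite !inE adj_distance2 nbrE.
move=> xsy; have neq : y != x by apply: contraTneq xsy => ->.
have neqs : y != s x by apply: contraTneq xsy => ->; rewrite sK adj_irr.
rewrite -(@taylor_mu (s x) (s y)).
- by apply: eq_card => z; rewrite !inE !adj_distance2 !nbrE.
- by rewrite (inj_eq (inv_inj sK)).
- by rewrite (inj_eq (inv_inj sK)).
- by rewrite adj_antipode -adj_antipode_r.
Qed.

Lemma taylor_array :
  G -> has_intersection_array G [:: k; k.-1 - a1; 1] [:: 1; k.-1 - a1; k].
Proof.
move=> x0; pose b1 := k.-1 - a1.
exists (nth 0 [:: 0; a1; a1; 0]), (nth 0 [:: k; b1; 1; 0]),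
  (nth 0 [:: 0; 1; b1; k]); rewrite taylor_diameter //; split=> //.
split; first exact: taylor_connected.
move=> x y /=.
(* Two of the three numbers at a distance determine the third. *)
have tot i : gdist x y = i ->
    #|[set z | adj y z & (gdist x z).+1 == i]|
    + #|[set z | adj y z & gdist x z == i]|
    + #|[set z | adj y z & gdist x z == i.+1]| = k.
  move=> <-; rewrite -(taylor_valency tG y) -!sum1dep_card.
  rewrite [RHS](bigID (fun z => (gdist x z).+1 == gdist x y)) /=.
  rewrite [X in _ = _ + X](bigID (fun z => gdist x z == gdist x y)) /= addnA.
  congr (_ + _ + _); apply: eq_bigl => z; case yz: (adj y z) => //=.
    by case: eqP => [->|]; rewrite ?andbT ?andbF // gtn_eqF.
  have := gdist_adj taylor_connected x yz.
  have := @gdist_adj _ taylor_connected x z y; rewrite adj_sym => /(_ yz).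
  by lia.
have d3 z : gdist x z == 3 = (z == s x).
  rewrite taylor_gdist; have [->|_] := eqVneq z x.
    by rewrite [RHS]eq_sym (negPf (s_neq x)).
  case: ifP => [xz|_]; last by case: ifP.
  by apply/esym; apply: contraTF xz => /eqP ->.
have conn := taylor_connected.
have le3 z : gdist x z <= 3 by rewrite taylor_gdist; do !case: ifP.
case dE: (gdist x y) (tot _ (erefl (gdist x y))) => [|[|[|[|d]]]] /=.
- move/eqP: dE; rewrite gdist_eq0 // => /eqP <- <-.
  have c0 : #|[set z | adj x z & (gdist x z).+1 == 0]| = 0.
    by apply: eq_card0 => z; rewrite !inE andbF.
  have a0 : #|[set z | adj x z & gdist x z == 0]| = 0.
    apply: eq_card0 => z; rewrite !inE gdist_eq0 //.
    by apply/andP=> -[xz /eqP zE]; rewrite -zE adj_irr in xz.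
  by rewrite c0 a0.
- move/eqP: dE; rewrite gdist_eq1 // => xy.
  have c1 : #|[set z | adj y z & (gdist x z).+1 == 1]| = 1.
    rewrite -[RHS](cards1 x); apply: eq_card => z; rewrite !inE eqSS gdist_eq0 //.
    by have [->|] := eqVneq z x; rewrite ?andbF // adj_sym xy.
  have a1E : #|[set z | adj y z & gdist x z == 1]| = a1.
    rewrite -(taylor_lambda tG xy); apply: eq_card => z.
    by rewrite !inE gdist_eq1 // andbC.
  by rewrite c1 a1E => tE; split=> //; rewrite /b1; lia.
- have [neq nxy neqs] : [/\ y != x, ~~ adj x y & y != s x].
    by move: dE; rewrite taylor_gdist; do !case: ifP.
  have c2 : #|[set z | adj y z & (gdist x z).+1 == 2]| = b1.
    rewrite /b1 -(taylor_mu neq neqs nxy); apply: eq_card => z.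
    by rewrite !inE eqSS gdist_eq1 // andbC.
  have b2 : #|[set z | adj y z & gdist x z == 3]| = 1.
    rewrite -[RHS](cards1 (s x)); apply: eq_card => z; rewrite !inE d3.
    have [->|] := eqVneq z (s x); rewrite ?andbF //.
    by rewrite adj_sym (antipode_adj tG) // nxy.
  by rewrite c2 b2 => tE; split=> //; rewrite /b1 in tE; lia.
- move/eqP: dE; rewrite d3 => /eqP ->.
  have a3 : #|[set z | adj (s x) z & gdist x z == 3]| = 0.
    apply: eq_card0 => z; rewrite !inE d3.
    by apply/andP=> -[sxz /eqP zE]; rewrite zE adj_irr in sxz.
  have b3 : #|[set z | adj (s x) z & gdist x z == 4]| = 0.
    apply: eq_card0 => z; rewrite !inE; apply/andP=> -[_ /eqP d4].
    by have := le3 z; rewrite d4.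
  by rewrite a3 b3 !addn0.
- by have := le3 y; rewrite dE.
Qed.

End TaylorGraphs.

(** * Distance-regular graphs of diameter three *)

Section DistanceRegular.
Variables (G : sgraph) (a b c : nat -> nat).
Hypothesis hG : distance_regular G a b c.
Implicit Types x y z : G.

Let conn : connected G := hG.1.

Lemma card_prev x y i : gdist x y = i.+1 ->
  #|[set z | adj y z & gdist x z == i]| = c i.+1.
Proof.
move=> d; have [+ _ _] := hG.2 x y; rewrite d => <-.
by apply: eq_card => z; rewrite !inE.
Qed.

Lemma card_same x y i : gdist x y = i ->
  #|[set z | adj y z & gdist x z == i]| = a i.
Proof. by move=> d; have [_ + _] := hG.2 x y; rewrite d. Qed.

Lemma card_next x y i : gdist x y = i ->
  #|[set z | adj y z & gdist x z == i.+1]| = b i.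
Proof. by move=> d; have [_ _] := hG.2 x y; rewrite d. Qed.

Lemma valency y : #|[set z | adj y z]| = b 0.
Proof.
rewrite -(card_next (gdistxx y)); apply: eq_card => z.
by rewrite !inE gdist_eq1 // andbb.
Qed.

Lemma intersection_sum x y :
  c (gdist x y) + a (gdist x y) + b (gdist x y) = b 0.
Proof.
have [<- <- <-] := hG.2 x y; rewrite -(valency y) -!sum1dep_card.
rewrite [RHS](bigID (fun z => (gdist x z).+1 == gdist x y)) /=.
rewrite [X in _ = _ + X](bigID (fun z => gdist x z == gdist x y)) /= addnA.
congr (_ + _ + _); apply: eq_bigl => z; case yz: (adj y z) => //=.
  by case: eqP => [->|]; rewrite ?andbT ?andbF // gtn_eqF.
have := gdist_adj conn x yz.
have := @gdist_adj _ conn x z y; rewrite adj_sym => /(_ yz).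
by lia.
Qed.

Definition sphere i x := [set y | gdist x y == i].

Lemma card_sphere0 x : #|sphere 0 x| = 1.
Proof.
rewrite -[RHS](cards1 x); apply: eq_card => y.
by rewrite !inE gdist_eq0 // eq_sym.
Qed.

Lemma card_sphere1 x : #|sphere 1 x| = b 0.
Proof.
by rewrite -(valency x); apply: eq_card => y; rewrite !inE gdist_eq1.
Qed.

(** Both sides count the edges between two consecutive spheres. *)
Lemma card_sphereS i x : #|sphere i x| * b i = #|sphere i.+1 x| * c i.+1.
Proof.
rewrite -!sum_nat_const.
rewrite (eq_bigr (fun y => \sum_(z in sphere i.+1 x) adj y z)); last first.
  move=> y; rewrite inE => /eqP /card_next <-; rewrite -sum1_card big_mkcond.
  rewrite [RHS]big_mkcond /=; apply: eq_bigr => z _; rewrite !inE.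
  by case: adj; case: eqP.
rewrite exchange_big /=; apply: eq_bigr => z; rewrite inE => /eqP /card_prev <-.
rewrite -sum1_card big_mkcond [RHS]big_mkcond /=; apply: eq_bigr => y _.
by rewrite !inE adj_sym; case: adj; case: eqP.
Qed.

Hypothesis hD : diameter G = 3.

Lemma le_gdist3 x y : gdist x y <= 3.
Proof. by rewrite -hD gdist_le_diameter. Qed.

Lemma card_spheres x :
  #|G| = 1 + b 0 + #|sphere 2 x| + #|sphere 3 x|.
Proof.
rewrite -(card_sphere1 x) -[X in X + _ + _ + _](card_sphere0 x).
rewrite -cardsT -!sum1_card.
rewrite (bigID (mem (sphere 0 x))) [X in _ + X = _](bigID (mem (sphere 1 x))) /=.
rewrite [X in _ + (_ + X) = _](bigID (mem (sphere 2 x))) /= !addnA.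
congr (_ + _ + _ + _); apply: eq_bigl => z; rewrite !inE //.
- by case: gdist => [|[|]].
- by case: gdist => [|[|[|]]].
- by have := le_gdist3 x z; case: gdist => [|[|[|[|]]]].
Qed.

Lemma ex_gdist3 : exists x y : G, gdist x y = 3.
Proof.
rewrite -hD; apply: diameter_attained; rewrite lt0n.
apply/eqP=> G0; move: hD; rewrite /diameter big_pred0 // => x.
by have /card0_eq/(_ x) := G0; rewrite !inE.
Qed.

Lemma ex_gdist2 : exists x y : G, gdist x y = 2.
Proof.
by have [x [y /(gdist_pred conn)[z _ d2]]] := ex_gdist3; exists x, z.
Qed.

Lemma ex_gdist1 : exists x y : G, gdist x y = 1.
Proof.
by have [x [y /(gdist_pred conn)[z _ d2]]] := ex_gdist2; exists x, z.
Qed.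

Lemma valency_gt0 : 0 < b 0.
Proof.
have [x [y /eqP]] := ex_gdist1; rewrite gdist_eq1 // => xy.
by rewrite -(valency x); apply/card_gt0P; exists y; rewrite inE.
Qed.

Lemma c1E : c 1 = 1.
Proof.
have [x [y d1]] := ex_gdist1; rewrite -(card_prev d1) -[RHS](cards1 x).
apply: eq_card => z; rewrite !inE gdist_eq0 //.
have [->|_] := eqVneq z x; last by rewrite andbF.
by rewrite adj_sym -gdist_eq1 // d1.
Qed.

Lemma c2_gt0 : 0 < c 2.
Proof.
have [x [y d2]] := ex_gdist2; rewrite -(card_prev d2).
by have [z yz dz] := gdist_pred conn d2; apply/card_gt0P; exists z; rewrite inE yz dz.
Qed.

(** Two vertices at distance 3 from x with a common neighbour are at distance at
   most 2 from each other, hence equal. *)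
Lemma antipodal_b2 : antipodal G -> b 2 = 1.
Proof.
move=> anti; have [x [z d3]] := ex_gdist3.
have [y zy d2] := gdist_pred conn d3.
rewrite -(card_next d2) -[RHS](cards1 z); apply: eq_card => t; rewrite !inE.
have [->|neq] := eqVneq t z; first by rewrite adj_sym zy d3.
apply/andP=> -[yt /eqP dt]; have [||zt3|tE] := anti x z t.
- by rewrite d3 hD.
- by rewrite dt hD.
- have := gdist_adj conn z yt; move: zy.
  by rewrite -gdist_eq1 // zt3 hD => /eqP ->.
- by rewrite tE eqxx in neq.
Qed.

(** Two adjacent vertices are not both antipodes of x, so a3 = 0. *)
Lemma antipodal_c3 : antipodal G -> c 3 = b 0.
Proof.
move=> anti; have [x [y d3]] := ex_gdist3.
rewrite -(intersection_sum x y) d3 -(card_same d3) -(card_next d3).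
rewrite !eq_card0 ?addn0 // => z; rewrite !inE.
  by apply/andP=> -[_ /eqP d4]; have := le_gdist3 x z; rewrite d4.
apply/andP=> -[yz /eqP dz]; have [||yz3|yE] := anti x y z.
- by rewrite d3 hD.
- by rewrite dz hD.
- by move: yz; rewrite -gdist_eq1 // yz3 hD.
- by rewrite yE adj_irr in yz.
Qed.

Hypothesis b2 : b 2 = 1.
Hypothesis c3 : c 3 = b 0.

Lemma card_sphere2 x : #|sphere 2 x| = #|sphere 3 x| * b 0.
Proof. by rewrite -c3 -card_sphereS b2 muln1. Qed.

Lemma b1E x : b 1 = #|sphere 3 x| * c 2.
Proof.
apply/eqP; rewrite -(eqn_pmul2l valency_gt0); apply/eqP.
by rewrite -{1}(card_sphere1 x) card_sphereS card_sphere2; ring.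
Qed.

Lemma a1E : (a 1 + b 1).+1 = b 0.
Proof.
by have [x [y d]] := ex_gdist1; rewrite -(intersection_sum x y) d c1E.
Qed.

Lemma a2E : (a 2 + c 2).+1 = b 0.
Proof.
have [x [y d]] := ex_gdist2; rewrite -(intersection_sum x y) d b2.
by lia.
Qed.

Lemma a3E : a 3 = 0.
Proof.
have [x [y d]] := ex_gdist3; have := intersection_sum x y; rewrite d c3.
by lia.
Qed.

(** With c2 = b1 a vertex has a single antipode s x; a vertex y at distance 2 from
   x has b2 = 1 neighbour at distance 3 from x, which must be s x. *)
Lemma distance_regular_taylor :
  b 1 = c 2 -> exists s : G -> G, taylor s (b 0) (a 1).
Proof.
move=> b1c2; have card3 x : #|sphere 3 x| = 1.
  have := b1E x; rewrite b1c2 => /eqP.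
  by rewrite -{1}[c 2]mul1n eqn_pmul2r ?c2_gt0 // => /eqP.
pose s x := odflt x [pick y | gdist x y == 3].
have sE x y : (gdist x y == 3) = (y == s x).
  have /eqP/cards1P[w /setP wE] := card3 x.
  have {}wE z : (gdist x z == 3) = (z == w) by have := wE z; rewrite !inE.
  rewrite /s; case: pickP => [z|/(_ w)]; rewrite !wE ?eqxx //.
  by move/eqP->.
have ds x : gdist x (s x) = 3 by apply/eqP; rewrite sE.
exists s; split.
- by move=> x; apply/esym/eqP; rewrite -sE gdist_sym ds.
- by move=> x; rewrite eq_sym -gdist_eq0 // ds.
- by move=> x; rewrite -gdist_eq1 // ds.
- move=> x y neq neqs; have := le_gdist3 x y.
  have d3 : gdist x y != 3 by rewrite sE.
  have d0 : gdist x y != 0 by rewrite gdist_eq0 // eq_sym.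
  have sxy_adj : adj (s x) y -> gdist x y != 1.
    move=> sxy; apply/eqP=> d1; have := gdist_adj conn x (y := y) (z := s x).
    by rewrite adj_sym sxy ds d1 => /(_ isT).
  rewrite -[adj x y]gdist_eq1 //.
  case dE: (gdist x y) d0 d3 sxy_adj => [|[|[|[|]]]] // _ _.
    by move=> /contraL/(_ isT)/negPf ->.
  move=> _ _ /=; have := card_next dE; rewrite b2.
  move/eqP/cards1P => [w /setP/(_ w)]; rewrite !inE eqxx sE.
  by case/andP=> yw /eqP <-; rewrite adj_sym.
- exact: valency.
- move=> x y xy; have /eqP d1 : gdist x y == 1 by rewrite gdist_eq1.
  rewrite -(card_same d1); apply: eq_card => z.
  by rewrite !inE gdist_eq1 // andbC.
Qed.

End DistanceRegular.

(** * Graphs in which every edge lies in a line *)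

(** Names for the points relative to two nonadjacent points X and Y: the Z i are
   their common neighbours, A i is the third point on the line of X and Z i, B i
   that of Y and Z i, C i j that of A i and B j, and W that of Z 0 and C 1 2. The
   point W is a new one only if there are three common neighbours. *)
Inductive label :=
  | LX | LY | LZ of nat | LA of nat | LB of nat | LC of nat & nat | LW.

Definition label_code (l : label) : nat * (nat * nat) :=
  match l with
  | LX => (0, (0, 0)) | LY => (1, (0, 0)) | LZ i => (2, (i, 0))
  | LA i => (3, (i, 0)) | LB i => (4, (i, 0)) | LC i j => (5, (i, j))
  | LW => (6, (0, 0))
  end.

Definition label_decode (c : nat * (nat * nat)) : label :=
  match c with
  | (0, _) => LX | (1, _) => LY | (2, (i, _)) => LZ i
  | (3, (i, _)) => LA i | (4, (i, _)) => LB i | (5, (i, j)) => LC i j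
  | _ => LW
  end.

Lemma label_codeK : cancel label_code label_decode.
Proof. by case. Qed.

HB.instance Definition _ := Equality.copy label (can_type label_codeK).

Definition label_adj (u v : label) : bool :=
  match u, v with
  | LX, LZ _ | LZ _, LX | LX, LA _ | LA _, LX => true
  | LY, LZ _ | LZ _, LY | LY, LB _ | LB _, LY => true
  | LZ i, LA j | LA j, LZ i | LZ i, LB j | LB j, LZ i => i == j
  | LA i, LB j | LB j, LA i => i != j
  | LZ i, LC j k | LC j k, LZ i => ~~ ((i == j) || (i == k))
  | LA i, LC j k | LC j k, LA i | LB i, LC j k | LC j k, LB i =>
      (i == j) || (i == k)
  | LC i j, LC k l => ~~ [|| k == i, k == j, l == i | l == j]
  | LW, LZ _ | LZ _, LW | LW, LC _ _ | LC _ _, LW => true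
  | _, _ => false
  end.

(** C i j and C j i name the same point, whence i < j. *)
Definition label_ok (s : nat) (u : label) : bool :=
  match u with
  | LX | LY => true
  | LZ i | LA i | LB i => i < s
  | LC i j => i < j < s
  | LW => s == 3
  end.

Definition labels (s : nat) : seq label :=
  [:: LX; LY] ++ [seq LZ i | i <- iota 0 s] ++ [seq LA i | i <- iota 0 s]
  ++ [seq LB i | i <- iota 0 s]
  ++ [seq LC i j | j <- iota 0 s, i <- iota 0 j] ++ nseq (s == 3) LW.

Section Lines.
Variables (T : finType) (e : rel T).
Hypotheses (e_sym : symmetric e) (e_irr : irreflexive e).

(** The triangle u, v, w is a line, and any other point p is collinear with exactly
   one of its points: the defining property of generalized quadrangles with three points on
   a line, in terms of their collinearity graphs. *)
Definition line_property := forall u v, e u v ->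
  exists2 w, e u w && e v w &
    forall p, p != u -> p != v -> p != w -> e p u + e p v + e p w = 1.

Hypothesis lineP : line_property.

Definition third u v := odflt u [pick w | e u w && e v w].

Lemma third_line u v : e u v -> e u (third u v) && e v (third u v).
Proof.
move=> /lineP[w wP _]; rewrite /third; case: pickP => // /(_ w).
by rewrite wP.
Qed.

Lemma eq_third u v p : e u v -> e u p -> e v p -> p = third u v.
Proof.
move=> uv; have /andP := third_line uv; have [w /andP[uw vw] wP] := lineP uv.
suff W q : e u q -> e v q -> q = w by case=> /W H /H -> uq vq; apply: W.
move=> uq vq; apply/eqP; apply: contraT => qw.
have /wP/(_ _ qw) : q != u by apply: contraTneq uq => ->; rewrite e_irr.
have nqv : q != v by apply: contraTneq vq => ->; rewrite e_irr.
by move/(_ nqv); rewrite e_sym uq e_sym vq.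
Qed.

(** Adjacency to the third point of a line is determined by adjacency to the
   other two: all the adjacencies below are computed with this rule. *)
Lemma third_adj u v p : e u v -> p != u -> p != v ->
  e p (third u v) = ~~ (e p u || e p v).
Proof.
move=> uv pu pv; have /andP[ut vt] := third_line uv.
have [w /andP[uw vw] wP] := lineP uv.
have <- := eq_third uv uw vw.
have [->|pw] := eqVneq p w; first by rewrite e_irr e_sym uw.
by move: (wP p pu pv pw); do 3!case: (e p _).
Qed.

Variables x y : T.
Hypotheses (neq_xy : x != y) (nadj_xy : e x y = false).

Let zs := enum [set z | e x z & e y z].
Let s := size zs.
Definition pt_z i := nth x zs i.
Definition pt_a i := third x (pt_z i).
Definition pt_b i := third y (pt_z i).
Definition pt_c i j := third (pt_a i) (pt_b j).
Definition pt_w := third (pt_z 0) (pt_c 1 2).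

Definition point (l : label) : T :=
  match l with
  | LX => x | LY => y | LZ i => pt_z i | LA i => pt_a i | LB i => pt_b i
  | LC i j => pt_c i j | LW => pt_w
  end.

Let xz i : i < s -> e x (pt_z i).
Proof. by move=> /(mem_nth x); rewrite mem_enum inE => /andP[]. Qed.

Let yz i : i < s -> e y (pt_z i).
Proof. by move=> /(mem_nth x); rewrite mem_enum inE => /andP[]. Qed.

Let zE p : e x p -> e y p -> exists2 i, i < s & p = pt_z i.
Proof.
move=> xp yp; have : p \in zs by rewrite mem_enum inE xp.
by exists (index p zs); rewrite ?index_mem // /pt_z nth_index.
Qed.

Let z_neq i j : i < s -> j < s -> (pt_z i == pt_z j) = (i == j).
Proof. by move=> si sj; rewrite nth_uniq // enum_uniq. Qed.

Let sep p u v : e p u -> e p v = false -> u != v.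
Proof. by move=> pu pv; apply: contraTneq pu => ->; rewrite pv. Qed.

Let sep' p u v : e p u -> e p v = false -> v != u.
Proof. by move=> pu /(sep pu); rewrite eq_sym. Qed.

Let neq_yx : y != x. Proof. by rewrite eq_sym. Qed.

Let nadj_yx : e y x = false. Proof. by rewrite e_sym. Qed.

Let zz i j : i < s -> j < s -> e (pt_z i) (pt_z j) = false.
Proof.
move=> si sj; apply/negP=> zij; case/negP: neq_xy; apply/eqP.
by rewrite (eq_third zij (p := x)) 1?(eq_third zij (p := y)) // e_sym ?xz ?yz.
Qed.

Let xa i : i < s -> e x (pt_a i).
Proof. by move=> /xz/third_line/andP[]. Qed.

Let yb i : i < s -> e y (pt_b i).
Proof. by move=> /yz/third_line/andP[]. Qed.

Let ya i : i < s -> e y (pt_a i) = false.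
Proof.
move=> si; rewrite third_adj ?xz //; first by rewrite yz // orbT.
exact: (sep' (xz si) nadj_xy).
Qed.

Let xb i : i < s -> e x (pt_b i) = false.
Proof.
move=> si; rewrite third_adj ?yz //; first by rewrite xz // orbT.
exact: (sep' (yz si) nadj_yx).
Qed.

Let za i j : i < s -> j < s -> e (pt_z i) (pt_a j) = (i == j).
Proof.
move=> si sj; have [<-|ij] := eqVneq i j; first by have /andP[] := third_line (xz si).
rewrite third_adj ?xz ?z_neq //; first by rewrite e_sym xz.
exact: (sep (yz si)).
Qed.

Let zb i j : i < s -> j < s -> e (pt_z i) (pt_b j) = (i == j).
Proof.
move=> si sj; have [<-|ij] := eqVneq i j; first by have /andP[] := third_line (yz si).
rewrite third_adj ?yz ?z_neq //; first by rewrite e_sym yz.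
exact: (sep (xz si)).
Qed.

Let aa i j : i < s -> j < s -> e (pt_a i) (pt_a j) = false.
Proof.
move=> si sj; have [<-|ij] := eqVneq i j; first by rewrite e_irr.
rewrite third_adj ?xz //; first by rewrite e_sym xa.
  by apply: (sep (xa si)); rewrite e_irr.
exact: (sep' (yz sj) (ya si)).
Qed.

Let bb i j : i < s -> j < s -> e (pt_b i) (pt_b j) = false.
Proof.
move=> si sj; have [<-|ij] := eqVneq i j; first by rewrite e_irr.
rewrite third_adj ?yz //; first by rewrite e_sym yb.
  by apply: (sep (yb si)); rewrite e_irr.
exact: (sep' (xz sj) (xb si)).
Qed.

Let ab i j : i < s -> j < s -> e (pt_a i) (pt_b j) = (i != j).
Proof.
move=> si sj; rewrite third_adj ?yz //.
- by rewrite e_sym ya // e_sym za // eq_sym.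
- exact: (sep (xa si)).
- exact: (sep' (yz sj) (ya si)).
Qed.

Let adj_c i j p : i < s -> j < s -> i != j -> p != pt_a i -> p != pt_b j ->
  e p (pt_c i j) = ~~ (e p (pt_a i) || e p (pt_b j)).
Proof. by move=> si sj ij; apply: third_adj; rewrite ab. Qed.

Let xc i j : i < s -> j < s -> i != j -> e x (pt_c i j) = false.
Proof.
move=> si sj ij; rewrite adj_c ?xa //; first by apply: (sep' (xa si)); rewrite e_irr.
exact: (sep' (yb sj)).
Qed.

Let yc i j : i < s -> j < s -> i != j -> e y (pt_c i j) = false.
Proof.
move=> si sj ij; rewrite adj_c ?yb ?orbT //; first exact: (sep' (xa si)).
by apply: (sep' (yb sj)); rewrite e_irr.
Qed.

Let zc i j l : i < s -> j < s -> l < s -> i != j ->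
  e (pt_z l) (pt_c i j) = ~~ ((l == i) || (l == j)).
Proof.
move=> si sj sl ij; rewrite adj_c ?za ?zb //.
  exact: (sep (yz sl) (ya si)).
exact: (sep (xz sl) (xb sj)).
Qed.

Let ac i j l : i < s -> j < s -> l < s -> i != j ->
  e (pt_a l) (pt_c i j) = (l == i) || (l == j).
Proof.
move=> si sj sl ij; have [->|li] := eqVneq l i.
  by have /andP[] : e (pt_a i) (pt_c i j) && e (pt_b j) (pt_c i j)
    by apply: third_line; rewrite ab.
rewrite adj_c ?aa ?ab ?negbK //; last exact: (sep (xa sl) (xb sj)).
by apply: (sep (p := pt_z l)); rewrite za ?eqxx ?(negPf li).
Qed.

Let bc i j l : i < s -> j < s -> l < s -> i != j ->
  e (pt_b l) (pt_c i j) = (l == i) || (l == j).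
Proof.
move=> si sj sl ij; have [->|lj] := eqVneq l j.
  rewrite orbT; have := @third_line (pt_a i) (pt_b j).
  by rewrite ab // => /(_ ij)/andP[].
have ba : e (pt_b l) (pt_a i) = (i != l) by rewrite e_sym ab.
rewrite adj_c ?bb ?ba ?(negPf lj) ?orbF ?negbK //.
  exact: (sep' (xa si) (xb sl)).
by apply: (sep (p := pt_z l)); rewrite zb ?eqxx ?(negPf lj).
Qed.

Let cc i j k l : i < s -> j < s -> k < s -> l < s -> i != j -> k != l ->
  e (pt_c i j) (pt_c k l) = ~~ [|| k == i, k == j, l == i | l == j].
Proof.
move=> si sj sk sl ij kl; rewrite adj_c //.
- by rewrite e_sym ac // e_sym bc // -orbA.
- exact: (sep' (xa sk) (xc si sj ij)).
- exact: (sep' (yb sl) (yc si sj ij)).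
Qed.

(** Of the two points other than x on a line through x exactly one is adjacent
   to y. *)
Lemma card_neighbours : #|[set p | e x p]| = s.*2.
Proof.
have yt p : e x p -> e y (third x p) = ~~ e y p.
  by move=> xp; rewrite third_adj ?nadj_yx // (sep' xp).
have tK p : e x p -> third x (third x p) = p.
  move=> xp; have /andP[xt pt] := third_line xp.
  by apply/esym/eq_third; rewrite // e_sym.
have xt p : e x p -> e x (third x p) by case/third_line/andP.
rewrite -(cardsID [set p | e y p]) -addnn; congr (_ + _).
  by rewrite /s /zs -cardE; apply: eq_card => p; rewrite !inE.
rewrite /s /zs -cardE -[RHS](card_in_imset (f := third x)) => [|p q].
  apply: eq_card => p; rewrite !inE; apply/andP/imsetP => [[nyp xp]|[q]].
    by exists (third x p); rewrite ?tK // inE xt // yt.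
  by rewrite inE => /andP[xq yq] ->; rewrite yt // yq xt.
by rewrite !inE => /andP[xp _] /andP[xq _] pq; rewrite -[p]tK // pq tK.
Qed.

(** The triples z0 c23 c45 and z1 c23 c45 would be lines through the same
   edge. *)
Lemma few_common_neighbours : s < 6.
Proof.
rewrite ltnNge; apply/negP => s6.
have L i : i < 6 -> i < s by move/leq_trans; apply.
have c2345 : e (pt_c 2 3) (pt_c 4 5) by rewrite cc ?L.
have zt i : i < 2 -> pt_z i = third (pt_c 2 3) (pt_c 4 5).
  by case: i => [|[|]] // _; apply: eq_third; rewrite // e_sym zc ?L.
by have := z_neq (L 0 isT) (L 1 isT); rewrite !zt // eqxx.
Qed.

(** The third point on the line of c01 and c23 is adjacent to x and y, and no
   z is adjacent to both c01 and c23. *)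
Lemma not_four_common_neighbours : s != 4.
Proof.
apply/eqP=> s4; have L i : i < 4 -> i < s by rewrite s4.
have c0123 : e (pt_c 0 1) (pt_c 2 3) by rewrite cc ?L.
have /andP[c01t c23t] := third_line c0123.
have xN i j : i < 4 -> j < 4 -> i != j -> x != pt_c i j.
  move=> si sj ij; apply: (sep' (p := pt_b i)).
    by rewrite bc ?L ?eqxx.
  by rewrite e_sym xb ?L.
have yN i j : i < 4 -> j < 4 -> i != j -> y != pt_c i j.
  move=> si sj ij; apply: (sep' (p := pt_a i)).
    by rewrite ac ?L ?eqxx.
  by rewrite e_sym ya ?L.
have [||i si tE] := @zE (third (pt_c 0 1) (pt_c 2 3)).
- by rewrite third_adj ?xN ?xc ?L.
- by rewrite third_adj ?yN ?yc ?L.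
move: c01t c23t; rewrite tE e_sym (zc (L 0 _) (L 1 _) si) //.
rewrite e_sym (zc (L 2 _) (L 3 _) si) //.
by move: si; rewrite s4; case: i {tE} => [|[|[|[|]]]].
Qed.

Section ThreeCommonNeighbours.
Hypothesis s3 : s = 3.

Let L i : i < 3 -> i < s. Proof. by rewrite s3. Qed.

Let z0c12 : e (pt_z 0) (pt_c 1 2).
Proof. by rewrite zc ?L. Qed.

Let w_adj p : p != pt_z 0 -> p != pt_c 1 2 ->
  e p pt_w = ~~ (e p (pt_z 0) || e p (pt_c 1 2)).
Proof. exact: third_adj z0c12. Qed.

Let xw : e x pt_w = false.
Proof.
rewrite w_adj ?xz ?L //; first by apply: (sep' (xz (L _))); rewrite // e_irr.
by apply: (sep' (p := pt_b 1)); rewrite ?bc 1?e_sym ?xb ?L.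
Qed.

Let yw : e y pt_w = false.
Proof.
rewrite w_adj ?yz ?L //; first by apply: (sep' (yz (L _))); rewrite // e_irr.
by apply: (sep' (p := pt_a 1)); rewrite ?ac 1?e_sym ?ya ?L.
Qed.

Let aw i : i < 3 -> e (pt_a i) pt_w = false.
Proof.
move=> i3; rewrite w_adj.
- by rewrite e_sym za ?ac ?L //; case: i i3 => [|[|[|]]].
- exact: (sep' (yz (L _)) (ya (L _))).
- exact: (sep (xa (L _)) (xc (L _) (L _) _)).
Qed.

Let bw i : i < 3 -> e (pt_b i) pt_w = false.
Proof.
move=> i3; rewrite w_adj.
- by rewrite e_sym zb ?bc ?L //; case: i i3 => [|[|[|]]].
- exact: (sep' (xz (L _)) (xb (L _))).
- exact: (sep (yb (L _)) (yc (L _) (L _) _)).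
Qed.

Let zw i : i < 3 -> e (pt_z i) pt_w.
Proof.
case: i => [|i] i3; first by have /andP[] := third_line z0c12.
rewrite w_adj ?zz ?zc ?z_neq ?L //; first by case: i i3 => [|[|]].
exact: (sep (xz (L _)) (xc (L _) (L _) _)).
Qed.

Let cw i j : i < j < 3 -> e (pt_c i j) pt_w.
Proof.
have c12 : e (pt_c 1 2) pt_w by have /andP[] := third_line z0c12.
have c0 k : 0 < k < 3 -> e (pt_c 0 k) pt_w.
  move=> /andP[k0 k3]; have zk : 0 != k by case: k k0 {k3}.
  rewrite w_adj.
  - by rewrite e_sym zc ?cc ?L //; case: k k0 k3 zk => [|[|[|]]].
  - by apply: (sep' (xz (L _)) (xc _ _ _)); rewrite ?L.
  - by apply: (sep' (p := pt_z 0)); rewrite ?zc ?L.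
case/andP=> ij j3; case: j j3 ij => [|[|[|]]] // _; case: i => [|[|]] // _.
- exact: c0.
- exact: c0.
Qed.

Lemma point_LW_adj u : label_ok 3 u -> e (point u) pt_w = label_adj u LW.
Proof.
case: u => [||i|i|i|i j|] /=; rewrite ?xw ?yw ?e_irr //.
- exact: zw.
- exact: aw.
- exact: bw.
- exact: cw.
Qed.

End ThreeCommonNeighbours.

(** The local graph is determined by the number s of common neighbours of two of
   its nonadjacent points. *)
Lemma point_adj u v : label_ok s u -> label_ok s v ->
  e (point u) (point v) = label_adj u v.
Proof.
have cN i j : i < j < s -> [/\ i < s, j < s & i != j].
  by move=> /andP[ij js]; rewrite (ltn_trans ij js) js ltn_eqF.
have [->|uW] := eqVneq u LW.
  move=> /= s3 vs; rewrite e_sym point_LW_adj; [|exact/eqP|].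
    by case: v vs.
  by rewrite -(eqP s3).
have [->|vW] := eqVneq v LW.
  by move=> us /= s3; rewrite point_LW_adj -?(eqP s3) //; exact/eqP.
case: u uW => [||i|i|i|i j|] //= _; case: v vW => [||k|k|k|k l|] //= _.
all: repeat match goal with |- is_true (_ < _ < _) -> _ => move=> /cN[? ? ?]
  | |- is_true (_ < _) -> _ => move=> ? | |- is_true true -> _ => move=> _ end.
all: rewrite ?e_irr ?nadj_xy ?nadj_yx //.
all: rewrite ?xz ?yz ?xa ?yb ?ya ?xb ?zz ?za ?zb ?aa ?bb ?ab ?xc ?yc ?zc ?ac ?bc ?cc //.
all: rewrite e_sym.
all: rewrite ?xz ?yz ?xa ?yb ?ya ?xb ?zz ?za ?zb ?aa ?bb ?ab ?xc ?yc ?zc ?ac ?bc ?cc //.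
all: by rewrite // eq_sym.
Qed.

End Lines.

(** * Coordinates on Taylor graphs *)

(** Distinct codes have different rows in r, which makes every map preserving
   adjacency injective. *)
Definition separated (V : eqType) (r : rel V) (cs : seq V) : bool :=
  uniq cs &&
  all (fun u => all (fun v => (u == v) || has (fun d => r u d != r v d) cs) cs)
    cs.

Definition framing (V : eqType) (r : rel V) (cs : seq V) (G : sgraph)
    (phi : V -> G) :=
  {in cs &, forall u v, adj (phi u) (phi v) = r u v}.

Lemma framing_inj (V : eqType) (r : rel V) cs (G : sgraph) (phi : V -> G) :
  separated r cs -> framing r cs phi -> {in cs &, injective phi}.
Proof.
case/andP=> _ /allP sep phiE u v uc vc uv.
have /allP/(_ v vc)/orP[/eqP //|/hasP[d dc]] := sep u uc.
by rewrite -!phiE // uv eqxx.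
Qed.

Lemma framing_onto (V : eqType) (r : rel V) cs (G : sgraph) (phi : V -> G) x :
  separated r cs -> #|G| <= size cs -> framing r cs phi ->
  has (fun u => phi u == x) cs.
Proof.
move=> sep cG phiE; have /andP[uc _] := sep.
have um : uniq (map phi cs).
  by rewrite map_inj_in_uniq //; apply: framing_inj phiE.
have sub : {subset map phi cs <= enum G} by move=> y _; rewrite mem_enum.
have [|_ E] := uniq_min_size um sub; first by rewrite -cardE size_map.
have : x \in map phi cs by rewrite E mem_enum.
by case/mapP=> u uin ->; apply/hasP; exists u.
Qed.

(** Framings by as many codes as there are vertices are bijections, so that phi and
   psi compose to an isomorphism. *)
Lemma framing_isomorphic (V : eqType) (r : rel V) cs (G H : sgraph)
    (phi : V -> G) (psi : V -> H) :
  V -> separated r cs -> #|G| <= size cs -> #|H| <= size cs ->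
  framing r cs phi -> framing r cs psi -> isomorphic G H.
Proof.
move=> u0 sep cG cH phiE psiE.
pose code (K : sgraph) (chi : V -> K) x := nth u0 cs (find (fun u => chi u == x) cs).
have codeP (K : sgraph) (chi : V -> K) x : #|K| <= size cs ->
    framing r cs chi -> code K chi x \in cs /\ chi (code K chi x) = x.
  move=> cK chiE; have h := framing_onto x sep cK chiE.
  by split; [rewrite mem_nth // -has_find | apply/eqP/(nth_find u0 h)].
have codeK (K : sgraph) (chi : V -> K) u : #|K| <= size cs ->
    framing r cs chi -> u \in cs -> code K chi (chi u) = u.
  move=> cK chiE uc; have [cc cu] := codeP K chi (chi u) cK chiE.
  exact: (framing_inj sep chiE).
exists (fun x => psi (code G phi x)).
  exists (fun y => phi (code H psi y)) => [x|y].
    by have [xc xE] := codeP G phi x cG phiE; rewrite codeK.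
  by have [yc yE] := codeP H psi y cH psiE; rewrite codeK.
move=> x y; have [xc xE] := codeP G phi x cG phiE.
have [yc yE] := codeP G phi y cG phiE.
by rewrite psiE // -phiE // xE yE.
Qed.

(** None names the base vertex and Some l a neighbour of it; the boolean selects
   the antipode of the named vertex. *)
Definition code : eqType := (bool * option label)%type.

(** Exchanging one of two vertices from different antipodal pairs with its
   antipode negates their adjacency. *)
Definition code_adj : rel code := fun u v =>
  (u.2 != v.2) && (u.1 (+) v.1 (+)
    (if u.2 is Some l then (if v.2 is Some m then label_adj l m else true)
     else true)).

Definition codes (t : nat) : seq code :=
  [seq (b, u) | b <- [:: false; true], u <- None :: map Some (labels t)].

Lemma separated_codes t : t \in [:: 2; 3; 5] -> separated code_adj (codes t).
Proof. by rewrite !inE => /or3P[]/eqP->; vm_compute. Qed.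

Lemma labels_ok t : t \in [:: 2; 3; 5] -> all (label_ok t) (labels t).
Proof. by rewrite !inE => /or3P[]/eqP->. Qed.

Lemma labels_separated t :
  t \in [:: 2; 3; 5] -> separated label_adj (labels t).
Proof. by rewrite !inE => /or3P[]/eqP->; vm_compute. Qed.

Section Coordinates.
Variables (G : sgraph) (s : G -> G) (k a1 : nat).
Hypothesis tG : taylor s k a1.
Hypotheses (a1_lt : a1 < k.-1) (kE : k = 3 * a1.-1).
Implicit Types x y z : G.

Let sK := antipodeK tG.
Let s_nadj := antipode_nadj tG.

Let adjsF x y : adj x y -> adj x (s y) = false.
Proof.
move=> xy; rewrite (adj_antipode_r tG) ?xy //; first by rewrite eq_sym adj_neq.
by apply: contraTneq xy => ->.
Qed.

(** Inclusion-exclusion on the k = 3 (a1 - 1) neighbours of x: those adjacent to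
   neither y nor z are antipodes of common neighbours of y and z. *)
Lemma triangle_common_neighbour x y z : adj x y -> adj x z -> adj y z ->
  #|[set w | [&& adj x w, adj y w & adj z w]]| = 1.
Proof.
move=> xy xz yz; set C := [set w | _].
pose N u := [set w : G | adj u w].
have cN2 u v : adj u v -> #|N u :&: N v| = a1.
  move=> /(taylor_lambda tG) <-; apply: eq_card => w; by rewrite !inE.
pose A := N x :&: N y; pose B := N x :&: N z.
have CE : C = A :&: B.
  by apply/setP=> w; rewrite !inE; case: adj; case: adj; case: adj.
have cU := cardsUI A B; rewrite -CE !cN2 // in cU.
have := cardsID (A :|: B) (N x).
have -> : N x :&: (A :|: B) = A :|: B.
  by apply/setP=> w; rewrite !inE; case: adj; case: adj; case: adj.
rewrite (taylor_valency tG) => cX.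
have := cardsID (N x) (N y :&: N z); rewrite cN2 //.
have -> : N y :&: N z :&: N x = C.
  by apply/setP=> w; rewrite !inE; case: adj; case: adj; case: adj.
suff -> : #|N y :&: N z :\: N x| = #|N x :\: (A :|: B)|.+1 by lia.
rewrite (cardsD1 x) !inE adj_irr (adj_sym y) xy (adj_sym z) xz /= add1n.
congr _.+1; rewrite -[RHS](card_imset _ (inv_inj sK)).
apply: eq_card => w; rewrite !inE; apply/idP/imsetP.
  case/and4P=> wx nxw yw zw; exists (s w); rewrite ?sK // !inE.
  rewrite (adjsF yw) (adjsF zw) !andbF /= (adj_antipode_r tG) //.
  by apply: contraTneq yw => ->; rewrite adjsF // adj_sym.
case=> v; rewrite !inE => /andP[nv xv] ->; move: nv; rewrite xv /=.
case/norP=> nyv nzv; rewrite (adjsF xv) /=.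
have vs u : adj x u -> v != s u.
  by move=> xu; apply: contraTneq xv => ->; rewrite adjsF.
rewrite !(adj_antipode_r tG) ?vs //.
- rewrite nyv nzv !andbT; apply: contraTneq xv => <-.
  by rewrite adj_sym s_nadj.
- by apply: contraNneq nyv => ->.
- by apply: contraNneq nzv => ->; rewrite adj_sym.
Qed.

Let fourth_uniq x y z v w : adj x y -> adj x z -> adj y z ->
  adj x v -> adj y v -> adj z v -> adj x w -> adj y w -> adj z w -> v = w.
Proof.
move=> xy xz yz xv yv zv xw yw zw.
have /eqP/cards1P[t /setP tE] := triangle_common_neighbour xy xz yz.
have := tE v; have := tE w; rewrite !inE xv yv zv xw yw zw.
by move=> /esym/eqP-> /esym/eqP.
Qed.

(** With w the fourth vertex on the triangle x, y, z, the three sets of common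
   neighbours of x with y, z and w meet pairwise in single vertices, and so
   cover all 3 (a1 - 1) neighbours of x. *)
Lemma triangle_line x y z : adj x y -> adj x z -> adj y z ->
  exists2 w, [&& adj x w, adj y w & adj z w] &
    forall p, adj x p -> p != y -> p != z -> p != w ->
      adj p y + adj p z + adj p w = 1.
Proof.
move=> xy xz yz.
have := triangle_common_neighbour xy xz yz.
move/eqP/cards1P => [w /setP wE]; have := wE w.
rewrite !inE eqxx => /and3P[xw yw zw].
exists w; first by rewrite xw yw.
pose M u := [set p | adj x p & adj u p].
have cM u : adj x u -> #|M u| = a1 by apply: taylor_lambda tG _ _.
have MI u v t : adj x u -> adj x v -> adj x t -> adj u v -> adj u t ->
    adj v t -> M u :&: M v = [set t].
  move=> xu xv xt uv ut vt; apply/setP=> p; rewrite !inE.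
  apply/idP/eqP=> [/andP[/andP[xp up] /andP[_ vp]]|->]; last by rewrite xt ut vt.
  exact: (fourth_uniq xu xv uv).
have cU := cardsUI (M y) (M z); rewrite (MI y z w) // cards1 !cM // in cU.
have cU' := cardsUI (M y :|: M z) (M w).
rewrite setIUl (MI y w z) ?(MI z w y) // 1?adj_sym // in cU'.
rewrite cards2 eq_sym (adj_neq yz) cM // in cU'.
have MN : M y :|: M z :|: M w = [set p | adj x p].
  apply/eqP; rewrite eqEcard (taylor_valency tG); apply/andP; split; last lia.
  by apply/subsetP=> p; rewrite !inE => /orP[/orP[]|] /andP[].
move=> p xp py pz pw; have /setP/(_ p) := MN.
rewrite !inE xp /= ![adj p _]adj_sym.
have two u v t : adj x u -> adj x v -> adj x t -> adj u v -> adj u t ->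
    adj v t -> p != t -> adj u p -> adj v p = false.
  move=> xu xv xt uv ut vt pt up; apply: contraNF pt => vp; apply/eqP.
  exact: (fourth_uniq xu xv uv).
case yp: (adj y p) => /=.
  by rewrite (two y z w) // (two y w z) // adj_sym.
case zp: (adj z p) => /=; last by move=> ->.
by rewrite (two z w y) // adj_sym.
Qed.

Variable o : G.

Let T := {u : G | adj o u}.
Let e : rel T := fun u v => adj (val u) (val v).

Let e_sym : symmetric e. Proof. by move=> u v; apply: adj_sym. Qed.
Let e_irr : irreflexive e. Proof. by move=> u; apply: adj_irr. Qed.

Let e_line : line_property e.
Proof.
move=> u v uv; have [w /and3P[ow uw vw] wP] := triangle_line (valP u) (valP v) uv.
exists (Sub w ow : T); first by rewrite /e !SubK uw.
move=> p pu pv pw; rewrite /e SubK; apply: wP; first exact: valP.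
- by rewrite (inj_eq val_inj).
- by rewrite (inj_eq val_inj).
- by apply: contra pw => /eqP pE; apply/eqP/val_inj; rewrite SubK.
Qed.

Let card_T (P : pred G) : #|[set u : T | P (val u)]| = #|[set u | adj o u & P u]|.
Proof.
rewrite -(card_imset _ val_inj); apply: eq_card => u; rewrite !inE.
apply/imsetP/andP=> [[v]|[ou Pu]]; first by rewrite inE => Pv ->; rewrite (valP v).
by exists (Sub u ou : T); rewrite ?inE SubK.
Qed.

(** The neighbours of the base vertex o satisfy the line property; two nonadjacent
   ones have t = a1 / 2 common neighbours among them, and name all the others. *)
Lemma taylor_framing : exists t (phi : code -> G),
  [/\ t \in [:: 2; 3; 5], a1 = t.*2 & framing code_adj (codes t) phi].
Proof.
have : 0 < k by lia.
rewrite -(taylor_valency tG o) => /card_gt0P[x0]; rewrite inE => ox.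
have : 0 < k.-1 - a1 by rewrite subn_gt0.
rewrite -(card_adj_nadj tG ox) => /card_gt0P[y0]; rewrite inE => /and3P[oy yx nxy].
pose x : T := Sub x0 ox; pose y : T := Sub y0 oy.
have neq_xy : x != y by rewrite -(inj_eq val_inj) !SubK eq_sym.
have nadj : e x y = false by rewrite /e !SubK (negPf nxy).
set t := size (enum [set z | e x z & e y z]).
have a1E : a1 = t.*2.
  rewrite -(card_neighbours e_sym e_irr e_line neq_xy nadj).
  rewrite (card_T (fun u => adj x0 u)) -(taylor_lambda tG ox).
  by apply: eq_card => u; rewrite !inE.
have t_in : t \in [:: 2; 3; 5].
  have := few_common_neighbours e_sym e_irr e_line neq_xy nadj.
  have := not_four_common_neighbours e_sym e_irr e_line neq_xy nadj.
  rewrite -/t; have : 1 < t by lia.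
  by case: (t) => [|[|[|[|[|[|]]]]]].
pose loc l := val (point e x y l).
have locE : {in labels t &, forall l m, adj (loc l) (loc m) = label_adj l m}.
  have /allP ok := labels_ok t_in.
  by move=> l m /ok ml /ok mm; apply: (point_adj e_sym e_irr e_line neq_xy nadj).
have locI := framing_inj (labels_separated t_in) locE.
have o_loc l : adj o (loc l) by apply: valP.
pose base (u : option label) := if u is Some l then loc l else o.
exists t, (fun c => if c.1 then s (base c.2) else base c.2); split=> //.
pose ok (u : option label) := if u is Some l then l \in labels t else true.
have baseE u v : ok u -> ok v ->
    adj (base u) (base v) = code_adj (false, u) (false, v) /\
    (base u == base v) = (u == v) /\ base u != s (base v).
  rewrite /code_adj; case: u v => [l|] [m|] /=.
  - move=> lin min; split.
      have [[->]|lm] := eqVneq (Some l) (Some m); first by rewrite adj_irr.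
      by rewrite locE.
    split; last by apply: contraTneq (o_loc l) => ->; rewrite adjsF.
    by apply/eqP/eqP=> [/locI->|[->]].
  - move=> _ _; rewrite adj_sym o_loc; split=> //; split.
      by apply/negbTE; rewrite eq_sym adj_neq.
    by apply: contraTneq (o_loc l) => ->; rewrite s_nadj.
  - move=> _ _; rewrite o_loc; split=> //; split.
      by apply/negbTE; rewrite adj_neq.
    by apply: contraTneq (o_loc m) => oE; rewrite oE adj_sym s_nadj.
  - move=> _ _; rewrite adj_irr; split=> //; split; rewrite ?eqxx //.
    by rewrite eq_sym (antipode_neq tG).
have mem_codes b u : (b, u) \in codes t -> ok u.
  case/allpairsP=> p [_ uin [_ ->]]; move: uin.
  by rewrite /ok inE => /orP[/eqP->|/mapP[l lin ->]].
move=> [b u] [d v] /mem_codes uin /mem_codes vin.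
have [uvE [uv_eq uvs]] := baseE _ _ uin vin.
have [_ [vu_eq vus]] := baseE _ _ vin uin.
rewrite /code_adj /= in uvE *.
have [uv|uv] := eqVneq u v.
  rewrite -uv /=; case: b d => [] []; rewrite ?adj_irr //.
    by rewrite adj_sym (negPf (s_nadj _)).
  by rewrite (negPf (s_nadj _)).
have nuv : base v != base u by rewrite vu_eq eq_sym.
rewrite uv /= in uvE *.
case: b d => [] [] /=.
- by rewrite (adj_antipode tG) uvE.
- by rewrite (antipode_adj tG) // uvE.
- by rewrite (adj_antipode_r tG) // uvE.
- by rewrite uvE.
Qed.

End Coordinates.

(** * Coordinates on the two small graphs *)

Lemma size_codes t : t \in [:: 2; 3; 5] -> size (codes t) = 12 * t - 4.
Proof. by rewrite !inE => /or3P[]/eqP->. Qed.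

Lemma taylor_framed_isomorphic (G : sgraph) (s : G -> G) (k a1 : nat)
    (H : sgraph) (phi : code -> H) :
  G -> taylor s k a1 -> a1 < k.-1 -> k = 3 * a1.-1 -> a1./2 \in [:: 2; 3; 5] ->
  framing code_adj (codes a1./2) phi -> #|H| <= 12 * a1./2 - 4 ->
  isomorphic G H.
Proof.
move=> o tG lt kE t_in phiE cH.
have [t [psi [_ a1E psiE]]] := taylor_framing tG lt kE o.
have tE : a1./2 = t by rewrite a1E doubleK.
rewrite -tE in psiE; apply: framing_isomorphic psiE phiE.
- exact: (false, None).
- exact: separated_codes.
- by rewrite size_codes // (card_taylor tG o); lia.
- by rewrite size_codes.
Qed.

(** Makes cardinals of explicit sets computable. *)
Lemma card_ord_count n (P : pred nat) :
  #|[set i : 'I_n | P i]| = count P (iota 0 n).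
Proof.
rewrite -sum1_count -[X in iota 0 X]subn0 big_mkord -sum1_card.
by apply: eq_bigl => i; rewrite inE.
Qed.

(** The base vertex is {0, 1, 2}; replacing one of its elements by another one
   gives a neighbour, and two such neighbours are adjacent when they agree in the
   element removed or in the one added. Antipodes are complements. *)
Definition johnson_code (c : code) : pred nat := fun i =>
  c.1 (+) (i \in match c.2 with
    | Some LX => [:: 1; 2; 3] | Some LY => [:: 0; 2; 4]
    | Some (LZ 0) => [:: 1; 2; 4] | Some (LZ _) => [:: 0; 2; 3]
    | Some (LA 0) => [:: 1; 2; 5] | Some (LA _) => [:: 0; 1; 3]
    | Some (LB 0) => [:: 0; 1; 4] | Some (LB _) => [:: 0; 2; 5]
    | Some _ => [:: 0; 1; 5]
    | None => [:: 0; 1; 2]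
    end).

Lemma johnson_framing :
  exists phi : code -> johnson 6 3, framing code_adj (codes 2) phi.
Proof.
pose S c := [set i : 'I_6 | johnson_code c i].
have S0 : #|S (false, None)| == 3 by rewrite card_ord_count.
pose x0 : johnson_vertex 6 3 := exist (fun A : {set 'I_6} => #|A| == 3) _ S0.
exists (fun c => insubd x0 (S c)) => c d cin din.
have sz : all (fun c => count (johnson_code c) (iota 0 6) == 3) (codes 2).
  by vm_compute.
have SE b : b \in codes 2 ->
    val (insubd x0 (S b)) = S b.
  by move=> /(allP sz); rewrite -card_ord_count => Sb; rewrite insubdK.
rewrite /= /johnson_adj /= !SE // -setIdE.
rewrite (_ : [set i in _ | _] =
  [set i : 'I_6 | johnson_code c i && johnson_code d i]); last first.
  by apply/setP=> i; rewrite !inE.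
rewrite (card_ord_count 6 (fun i => johnson_code c i && johnson_code d i)).
have chk : all (fun c => all (fun d =>
   ((count (fun i => johnson_code c i && johnson_code d i) (iota 0 6)).+1 == 3)
   == code_adj c d) (codes 2)) (codes 2) by vm_compute.
by have /allP/(_ d din)/eqP := allP chk c cin.
Qed.

Lemma card_johnson n m : #|johnson n m| = 'C(n, m).
Proof.
by rewrite card_sig -[n in RHS]card_ord -card_draws; apply: eq_card => A; rewrite !inE.
Qed.

(** The base vertex is the zero word. The words at Hamming distance 4 from it are
   the complements of the edges of K6, and two of them are at Hamming distance 4
   when the edges are disjoint. The edges are listed here. *)
Definition halved_cube_code (c : code) : pred nat := fun i =>
  c.1 (+) (if c.2 is Some l then
    i \notin match l with
    | LX => [:: 0; 1] | LY => [:: 0; 2]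
    | LZ 0 => [:: 3; 4] | LZ 1 => [:: 3; 5] | LZ _ => [:: 4; 5]
    | LA 0 => [:: 2; 5] | LA 1 => [:: 2; 4] | LA _ => [:: 2; 3]
    | LB 0 => [:: 1; 5] | LB 1 => [:: 1; 4] | LB _ => [:: 1; 3]
    | LC 0 1 => [:: 0; 3] | LC 0 _ => [:: 0; 4] | LC _ _ => [:: 0; 5]
    | LW => [:: 1; 2]
    end else false).

Definition hamming n (v w : {ffun 'I_n -> bool}) := #|[set i | v i != w i]|.

Lemma hamming_triangle n (u v w : {ffun 'I_n -> bool}) :
  hamming u w <= hamming u v + hamming v w.
Proof.
apply: leq_trans (leq_card_setU _ _); apply/subset_leq_card/subsetP => i.
by rewrite !inE; do !case: (fun_of_fin _ i).
Qed.

Lemma distance2_halved_cube_framing :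
  exists phi : code -> distance2_graph (halved_cube 6),
    framing code_adj (codes 3) phi.
Proof.
pose S c : {ffun 'I_6 -> bool} := [ffun i : 'I_6 => halved_cube_code c i].
have SE c i : S c i = halved_cube_code c i by rewrite ffunE.
have cS c : #|[set i | S c i]| = count (halved_cube_code c) (iota 0 6).
  by rewrite -card_ord_count; apply: eq_card => i; rewrite !inE SE.
have S0 : ~~ odd #|[set i | S (false, None) i]| by rewrite cS.
pose x0 : even_word 6 := 
  exist (fun w : {ffun 'I_6 -> bool} => ~~ odd #|[set i | w i]|) _ S0.
pose phi c : halved_cube 6 := insubd x0 (S c).
have ev : all (fun c => ~~ odd (count (halved_cube_code c) (iota 0 6))) (codes 3).
  by vm_compute.
have phiE c : c \in codes 3 -> val (phi c) = S c.
  by move=> /(allP ev); rewrite -cS => ev_c; rewrite /phi insubdK.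
pose ham c d := hamming (S c) (S d).
have hamE c d : ham c d =
    count (fun i => halved_cube_code c i != halved_cube_code d i) (iota 0 6).
  by rewrite -card_ord_count; apply: eq_card => i; rewrite !inE !SE.
have adjE c d : c \in codes 3 -> d \in codes 3 ->
    adj (phi c) (phi d) = (ham c d == 2).
  by move=> cin din; rewrite /ham -(phiE c cin) -(phiE d din).
have lt2 : 2 < #|halved_cube 6|.
  apply/card_gt2P; exists (phi (false, Some LX)), (phi (false, Some LY)),
    (phi (false, Some (LC 0 1))); split=> //.
  by split; apply: adj_neq; rewrite adjE // hamE.
(* Distance 2 in the halved cube is Hamming distance 4; the Hamming distance 6 is
   excluded by the triangle inequality. *)
have {hamE} chk : all (fun c => all (fun d => [&& (ham c d == 4) == code_adj c d,
    (ham c d == 0) ==> (c == d), ham c d \in [:: 0; 2; 4; 6] &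
    (ham c d == 4) ==>
      has (fun b => (ham c b == 2) && (ham b d == 2)) (codes 3)])
  (codes 3)) (codes 3).
  pose h c d :=
    count (fun i => halved_cube_code c i != halved_cube_code d i) (iota 0 6).
  rewrite (eq_all (a2 := fun c => all (fun d => [&& (h c d == 4) == code_adj c d,
    (h c d == 0) ==> (c == d), h c d \in [:: 0; 2; 4; 6] &
    (h c d == 4) ==> has (fun b => (h c b == 2) && (h b d == 2)) (codes 3)])
    (codes 3))); first by vm_compute.
  move=> c; apply: eq_all => d; rewrite !hamE; do 3!congr (_ && _).
  by congr (_ ==> _); apply: eq_has => b; rewrite !hamE.
exists phi => c d cin din; rewrite /= /dist2_adj /= (gdist_eq2 _ _ lt2).
have /allP/(_ d din)/and4P[/eqP <- /implyP h0 hin /implyP h4] := allP chk c cin.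
rewrite (adjE c d cin din).
apply/and3P/eqP => [[neq n2 /existsP[z /andP[cz zd]]]|hE].
  have : ham c d <= 4.
    rewrite /ham -(phiE c cin) -(phiE d din).
    apply: leq_trans (hamming_triangle _ (val z) _) _.
    by move: cz zd; rewrite /= /halved_cube_adj /= /hamming => /eqP-> /eqP->.
  have : ham c d != 0 by apply: contra neq => /h0/eqP->.
  by move: hin n2; rewrite !inE => /or4P[]/eqP->.
split; last first.
- have /hasP[b bin /andP[cb bd]] := h4 (introT eqP hE).
  by apply/existsP; exists (phi b); rewrite !adjE ?cb.
- by rewrite hE.
apply: contra_eqN hE => /eqP cd.
rewrite /ham -(phiE c cin) -(phiE d din) cd /hamming.
by rewrite (_ : [set _ | _] = set0) ?cards0 //; apply/setP=> i; rewrite !inE eqxx.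
Qed.

(** Flipping one letter sends even words to odd ones. *)
Lemma card_halved_cube n : #|halved_cube n.+1| <= 2 ^ n.
Proof.
pose E := [set w : {ffun 'I_n.+1 -> bool} | ~~ odd #|[set i | w i]|].
have -> : #|halved_cube n.+1| = #|E|.
  by rewrite card_sig; apply: eq_card => w; rewrite !inE.
pose f (w : {ffun 'I_n.+1 -> bool}) := [ffun i => w i (+) (i == ord0)].
have fK : involutive f.
  by move=> w; apply/ffunP=> i; rewrite !ffunE addbK.
have sub : f @: E \subset ~: E.
  apply/subsetP=> _ /imsetP[w wE ->]; move: wE; rewrite !inE !negbK.
  rewrite (cardsD1 ord0) [X in _ -> odd X](cardsD1 ord0) !oddD.
  have -> : [set i | f w i] :\ ord0 = [set i | w i] :\ ord0.
    by apply/setP=> i; rewrite !inE ffunE; case: eqP => // _; rewrite addbF.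
  by rewrite !inE ffunE eqxx !oddb; case: (w ord0) => /=; case: odd.
have := subset_leq_card sub; rewrite (card_imset _ (inv_inj fK)).
have := cardsC E; rewrite card_ffun card_bool card_ord expnS.
lia.
Qed.

(** * Distance matrices and their eigenvalues *)

Local Open Scope ring_scope.

Section DistanceMatrices.
Variables (R : realType) (G : sgraph) (a b c : nat -> nat).
Hypotheses (hG : distance_regular G a b c) (hD : diameter G = 3%N).
Hypotheses (b2 : b 2%N = 1%N) (c3 : c 3%N = b 0%N).

Let conn : connected G := hG.1.

Definition dist_mx i : 'M[R]_#|G| :=
  \matrix_(x, y) (gdist (enum_val x) (enum_val y) == i)%:R.

Let A := adjacency_mx R G.
Let J : 'M[R]_#|G| := const_mx 1.
Let k := b 0%N.

Lemma sum_indicator (S : {set G}) :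
  \sum_(x < #|G|) (enum_val x \in S)%:R = #|S|%:R :> R.
Proof.
rewrite -(big_enum_val (A := G) (fun x => (x \in S)%:R)) -sum1_card natr_sum.
by rewrite [RHS]big_mkcond; apply: eq_bigr => x _; case: (x \in S).
Qed.

Lemma dist_mx1 : dist_mx 1 = A.
Proof. by apply/matrixP=> x y; rewrite !mxE gdist_eq1. Qed.

Lemma dist_mx0 : dist_mx 0 = 1%:M.
Proof.
by apply/matrixP=> x y; rewrite !mxE gdist_eq0 // (inj_eq enum_val_inj).
Qed.

Lemma dist_mx_mulE i x y : (dist_mx i *m A) x y =
  #|[set z | adj (enum_val y) z & gdist (enum_val x) z == i]|%:R.
Proof.
rewrite mxE -sum_indicator; apply: eq_bigr => z _.
by rewrite !mxE -natrM mulnb inE andbC adj_sym.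
Qed.

Lemma gdist_cases x y : gdist (x : G) y \in [:: 0; 1; 2; 3]%N.
Proof. by have := le_gdist3 hD x y; case: gdist => [|[|[|[|]]]]. Qed.

Lemma adjacency_sqr :
  A *m A = k%:R%:M + (a 1%N)%:R *: A + (c 2%N)%:R *: dist_mx 2.
Proof.
apply/matrixP=> x y; rewrite -{1}dist_mx1 dist_mx_mulE.
rewrite -dist_mx1 -scalemx1 -dist_mx0 !mxE.
set u := enum_val x; set v := enum_val y.
have := gdist_cases u v; rewrite !inE => /or4P[]/eqP dE; rewrite dE /=.
- by rewrite (card_next hG dE) !mulr0 mulr1 !addr0.
- by rewrite (card_same hG dE) !mulr0 mulr1 !addr0 add0r.
- by rewrite (card_prev hG dE) !mulr0 mulr1 !add0r.
- rewrite !mulr0 !addr0 eq_card0 // => z; rewrite !inE.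
  apply/andP=> -[vz /eqP d1]; have := gdist_adj conn u (y := z) (z := v).
  by rewrite adj_sym vz dE d1 => /(_ isT).
Qed.

Lemma dist2_mul_adjacency :
  dist_mx 2 *m A = (b 1%N)%:R *: A + (a 2%N)%:R *: dist_mx 2 + k%:R *: dist_mx 3.
Proof.
apply/matrixP=> x y; rewrite dist_mx_mulE -dist_mx1 !mxE.
set u := enum_val x; set v := enum_val y.
have := gdist_cases u v; rewrite !inE => /or4P[]/eqP dE; rewrite dE /=.
- rewrite !mulr0 !addr0 eq_card0 // => z; rewrite !inE.
  apply/andP=> -[vz /eqP d2]; have := gdist_adj conn u vz.
  by rewrite dE d2.
- by rewrite (card_next hG dE) !mulr0 mulr1 !addr0.
- by rewrite (card_same hG dE) !mulr0 mulr1 !addr0 add0r.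
- by rewrite (card_prev hG dE) c3 !mulr0 mulr1 !add0r.
Qed.

Lemma dist3_mul_adjacency : dist_mx 3 *m A = dist_mx 2.
Proof.
apply/matrixP=> x y; rewrite dist_mx_mulE !mxE.
set u := enum_val x; set v := enum_val y.
have := gdist_cases u v; rewrite !inE => /or4P[]/eqP dE; rewrite dE /=.
- rewrite eq_card0 // => z; rewrite !inE.
  apply/andP=> -[vz /eqP d3]; have := gdist_adj conn u vz.
  by rewrite dE d3.
- rewrite eq_card0 // => z; rewrite !inE.
  apply/andP=> -[vz /eqP d3]; have := gdist_adj conn u vz.
  by rewrite dE d3.
- by rewrite (card_next hG dE) b2.
- by rewrite (card_same hG dE) (a3E hG hD b2 c3).
Qed.

Lemma sum_dist_mx : 1%:M + A + dist_mx 2 + dist_mx 3 = J.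
Proof.
apply/matrixP=> x y; rewrite -dist_mx1 -dist_mx0 !mxE.
have := gdist_cases (enum_val x) (enum_val y).
by rewrite !inE => /or4P[]/eqP ->; rewrite /= ?addr0 ?add0r.
Qed.

Lemma ones_dist_mx i n : (forall x : G, #|sphere i x| = n) ->
  (const_mx 1 : 'rV[R]_#|G|) *m dist_mx i = n%:R *: const_mx 1.
Proof.
move=> cS; apply/rowP=> y; rewrite !mxE mulr1 -(cS (enum_val y)).
rewrite -sum_indicator; apply: eq_bigr => x _.
by rewrite !mxE mul1r inE gdist_sym.
Qed.

Lemma adjacency_mul_ones : A *m (const_mx 1 : 'cV[R]_#|G|) = k%:R *: const_mx 1.
Proof.
apply/colP=> y; rewrite !mxE mulr1 /k -(valency hG (enum_val y)).
rewrite -sum_indicator; apply: eq_bigr => x _.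
by rewrite !mxE mulr1 inE.
Qed.

(** The all-ones vector is an eigenvector of the symmetric matrix A for k. *)
Lemma eigenvector_orthogonal_ones theta (v : 'rV[R]_#|G|) :
  v *m A = theta *: v -> theta != k%:R -> v *m J = 0.
Proof.
move=> vA tk; have v1 : v *m (const_mx 1 : 'cV[R]_#|G|) = 0.
  have : (theta - k%:R) *: (v *m (const_mx 1 : 'cV[R]_#|G|)) = 0.
    rewrite scalerBl scalemxAl -vA -mulmxA adjacency_mul_ones -scalemxAr.
    by rewrite subrr.
  by move/eqP; rewrite scaler_eq0 subr_eq0 (negPf tk) => /eqP.
apply/rowP=> y.
transitivity ((v *m (const_mx 1 : 'cV[R]_#|G|)) 0 0); last by rewrite v1 !mxE.
by rewrite !mxE; apply: eq_bigr => x _; rewrite !mxE.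
Qed.

Variable e : nat.
Hypothesis card3 : forall x : G, #|sphere 3 x| = e.

Let valencyRE : 1 + (a 1%N)%:R + (b 1%N)%:R = k%:R :> R.
Proof. by rewrite /k -(a1E hG hD) -natr1 natrD; ring. Qed.


(** On the orthogonal complement of the all-ones vector the relations
   A3 A = A2 and 1 + A + A2 + A3 = J give (theta + 1) (gamma + 1) = 0, where
   gamma is the eigenvalue of A3. *)
Lemma dist_mx_eigenvector theta (v : 'rV[R]_#|G|) :
  v *m A = theta *: v -> v != 0 -> theta != k%:R ->
  (theta = -1 /\ v *m dist_mx 2 = - e%:R *: v /\ v *m dist_mx 3 = e%:R *: v) \/
  (theta ^+ 2 = ((a 1%N)%:R - (c 2%N)%:R) * theta + k%:R /\
   v *m dist_mx 2 = - theta *: v /\ v *m dist_mx 3 = -1 *: v).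
Proof.
move=> vA v0 tk; have [x0 _] := ex_gdist3 hD; have vJ := eigenvector_orthogonal_ones vA tk.
have c2_neq0 : (c 2%N)%:R != 0 :> R by rewrite pnatr_eq0 -lt0n (c2_gt0 hG hD).
have kR : k%:R != 0 :> R by rewrite pnatr_eq0 -lt0n (valency_gt0 hG hD).
have vAA : v *m (A *m A) = theta ^+ 2 *: v.
  by rewrite mulmxA vA -scalemxAl vA scalerA.
pose beta := (theta ^+ 2 - k%:R - (a 1%N)%:R * theta) / (c 2%N)%:R.
have v2 : v *m dist_mx 2 = beta *: v.
  have := vAA; rewrite adjacency_sqr !mulmxDr mul_mx_scalar -!scalemxAr vA.
  move: (v *m dist_mx 2) => w /rowP E; apply/rowP=> j.
  have := E j; rewrite !mxE /beta => Ej; apply: (mulfI c2_neq0).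
  by rewrite mulrA mulrCA divff // mulr1; lra.
pose gamma := (beta * theta - (b 1%N)%:R * theta - (a 2%N)%:R * beta) / k%:R.
have v3 : v *m dist_mx 3 = gamma *: v.
  have := congr1 (mulmx v) dist2_mul_adjacency.
  rewrite mulmxA v2 -scalemxAl !mulmxDr -!scalemxAr vA v2.
  move: (v *m dist_mx 3) => w /rowP E; apply/rowP=> j.
  have := E j; rewrite !mxE /gamma => Ej; apply: (mulfI kR).
  by rewrite mulrA mulrCA divff // mulr1; lra.
have gE : theta * gamma = beta.
  have : v *m dist_mx 3 *m A = v *m dist_mx 2 by rewrite -mulmxA dist3_mul_adjacency.
  rewrite v2 v3 -scalemxAl vA scalerA => /eqP; rewrite -subr_eq0 -scalerBl.
  by rewrite scaler_eq0 (negPf v0) orbF subr_eq0 mulrC => /eqP.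
have sE : (theta + 1) * (gamma + 1) = 0.
  have := congr1 (mulmx v) sum_dist_mx.
  rewrite vJ !mulmxDr mulmx1 vA v2 v3 -{1}[v]scale1r -!scalerDl => /eqP.
  rewrite scaler_eq0 (negPf v0) orbF => /eqP sE.
  by rewrite mulrDl mulrDr gE; lra.
have bE : (c 2%N)%:R * beta = theta ^+ 2 - k%:R - (a 1%N)%:R * theta.
  by rewrite /beta mulrCA divff // mulr1.
move/eqP: sE; rewrite mulf_eq0 => /orP[]/eqP sE.
  have tE : theta = -1 by lra.
  have beE : beta = - e%:R.
    apply: (mulfI c2_neq0); rewrite bE tE.
    have /(congr1 (fun n => n%:R : R)) := b1E hG hD b2 c3 x0.
    rewrite card3 natrM => b1R.
    by rewrite -valencyRE b1R; ring.
  left; rewrite v2 v3 beE; split=> //; split=> //; congr (_ *: _).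
  by move: gE; rewrite tE beE; lra.
have gN : gamma = -1 by lra.
have beE : beta = - theta by rewrite -gE gN mulrN1.
right; rewrite v2 v3 beE gN; split=> //.
by move: bE; rewrite beE; lra.
Qed.

(** The roots of the quadratic lie on both sides of -1, where its value is
   - (b1 + c2). *)
Lemma adjacency_spectrum theta1 theta2 theta3 :
  eigenvalue A theta1 -> eigenvalue A theta2 -> eigenvalue A theta3 ->
  theta1 < k%:R -> theta2 < theta1 -> theta3 < theta2 ->
  [/\ theta2 = -1, theta1 * theta3 = - k%:R,
      theta1 + theta3 = (a 1%N)%:R - (c 2%N)%:R & theta3 < -1 < theta1].
Proof.
move=> ev1 ev2 ev3 lt1 lt2 lt3.
have kE := valencyRE.
have c2_gt : 0 < (c 2%N)%:R :> R by rewrite ltr0n (c2_gt0 hG hD).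
have b1_ge : 0 <= (b 1%N)%:R :> R by rewrite ler0n.
have rootP t : eigenvalue A t -> t < k%:R ->
    t = -1 \/ t ^+ 2 = ((a 1%N)%:R - (c 2%N)%:R) * t + k%:R.
  case/eigenvalueP=> v vA v0 tk.
  have tk' : t != k%:R by rewrite lt_eqF.
  by have [[-> _]|[-> _]] := dist_mx_eigenvector vA v0 tk'; [left|right].
have sumE (t t' : R) : t' < t -> t ^+ 2 = ((a 1%N)%:R - (c 2%N)%:R) * t + k%:R ->
    t' ^+ 2 = ((a 1%N)%:R - (c 2%N)%:R) * t' + k%:R -> t + t' = (a 1%N)%:R - (c 2%N)%:R.
  move=> tt' tE t'E; apply: (mulfI (x := t - t')); last by lra.
  by rewrite subr_eq0 gt_eqF.
have prodE (t t' : R) : t' < t -> t ^+ 2 = ((a 1%N)%:R - (c 2%N)%:R) * t + k%:R ->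
    t' ^+ 2 = ((a 1%N)%:R - (c 2%N)%:R) * t' + k%:R ->
    t + t' = (a 1%N)%:R - (c 2%N)%:R /\ t * t' = - k%:R.
  by move=> tt' tE t'E; have sE := sumE t t' tt' tE t'E; split=> //; rewrite -sE in tE; lra.
have sep (t t' : R) : t' < t -> t ^+ 2 = ((a 1%N)%:R - (c 2%N)%:R) * t + k%:R ->
    t' ^+ 2 = ((a 1%N)%:R - (c 2%N)%:R) * t' + k%:R -> (t + 1) * (t' + 1) < 0.
  by move=> tt' tE t'E; have [sE pE] := prodE t t' tt' tE t'E; lra.
have [t1|t1] := rootP _ ev1 lt1; have [t2|t2] := rootP _ ev2 (lt_trans lt2 lt1);
  have [t3|t3] := rootP _ ev3 (lt_trans lt3 (lt_trans lt2 lt1)).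
- by lra.
- by lra.
- by lra.
- by have := sep _ _ lt3 t2 t3; nra.
- by lra.
- have lt13 := lt_trans lt3 lt2; have [sE pE] := prodE _ _ lt13 t1 t3.
  by split=> //; apply/andP; split; lra.
- by have := sep _ _ lt2 t1 t2; nra.
- by have := sumE _ _ lt2 t1 t2; have := sumE _ _ (lt_trans lt3 lt2) t1 t3; lra.
Qed.

Lemma qdistance_mxE (q : R) : qdistance_mx G q =
  A + (1 + q^-1) *: dist_mx 2 + (1 + q^-1 + q^-1 ^+ 2) *: dist_mx 3.
Proof.
apply/matrixP=> x y; rewrite -dist_mx1 !mxE.
have := gdist_cases (enum_val x) (enum_val y).
rewrite !inE => /or4P[]/eqP -> /=.
- by rewrite big_ord0 !mulr0 !addr0.
- by rewrite big_ord1 expr0 invr1 !mulr0 !addr0.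
- by rewrite !big_ord_recr big_ord0 /= expr0 expr1 invr1; ring.
- rewrite !big_ord_recr big_ord0 /= expr0 expr1 invr1 exprVn; ring.
Qed.

Let x0P : exists x : G, True.
Proof. by have [x _] := ex_gdist3 hD; exists x. Qed.

Lemma card_sphere2_const (x : G) : #|sphere 2 x| = (e * k)%N.
Proof. by rewrite (card_sphere2 hG b2 c3) card3. Qed.

Lemma qdistance_eigenvalue_valency (q : R) (u := q^-1) :
  eigenvalue (qdistance_mx G q)
    (k%:R + (1 + u) * (e%:R * k%:R) + (1 + u + u ^+ 2) * e%:R).
Proof.
apply/eigenvalueP; exists (const_mx 1).
  rewrite qdistance_mxE !mulmxDr -!scalemxAr -dist_mx1.
  rewrite (ones_dist_mx (card_sphere1 hG)) (ones_dist_mx card_sphere2_const).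
  by rewrite (ones_dist_mx card3) !scalerA -!scalerDl natrM.
have [x _] := x0P; apply/eqP => /rowP/(_ (enum_rank x)); rewrite !mxE.
by move/eqP; rewrite oner_eq0.
Qed.

Lemma qdistance_eigenvalue theta (q : R) (u := q^-1) :
  eigenvalue A theta -> theta != k%:R ->
  if theta == -1 then eigenvalue (qdistance_mx G q) (-1 + u ^+ 2 * e%:R)
  else eigenvalue (qdistance_mx G q) (- u * theta - (1 + u + u ^+ 2)).
Proof.
case/eigenvalueP=> v vA v0 tk.
have vD : v *m qdistance_mx G q =
    v *m A + (1 + u) *: (v *m dist_mx 2) + (1 + u + u ^+ 2) *: (v *m dist_mx 3).
  by rewrite qdistance_mxE !mulmxDr -!scalemxAr.
have [[tE [v2 v3]]|[tE [v2 v3]]] := dist_mx_eigenvector vA v0 tk.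
  rewrite tE eqxx; apply/eigenvalueP; exists v => //.
  rewrite vD vA v2 v3 tE !scalerA -!scalerDl; congr (_ *: _); ring.
have -> : (theta == -1) = false.
  apply/negbTE/eqP=> t1; move: tE; rewrite t1.
  have kE := valencyRE.
  have c2_gt : 0 < (c 2%N)%:R :> R by rewrite ltr0n (c2_gt0 hG hD).
  have b1_ge : 0 <= (b 1%N)%:R :> R by rewrite ler0n.
  by lra.
apply/eigenvalueP; exists v => //.
rewrite vD vA v2 v3 !scalerA -!scalerDl; congr (_ *: _); ring.
Qed.

(** As u is nonzero, theta1 and theta3 already give two distinct eigenvalues, so
   those of k and theta2 = -1 occur among them. *)
Lemma two_qdistance_eigenvalues theta1 theta2 theta3 q (u := q^-1) (s : seq R) :
  eigenvalue A theta1 -> eigenvalue A theta2 -> eigenvalue A theta3 ->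
  theta1 < k%:R -> theta2 < theta1 -> theta3 < theta2 -> q != 0 ->
  size s = 2%N -> (forall x, eigenvalue (qdistance_mx G q) x = (x \in s)) ->
  let val t := - u * t - (1 + u + u ^+ 2) in
  let val_k := k%:R + (1 + u) * (e%:R * k%:R) + (1 + u + u ^+ 2) * e%:R in
  let val_m := -1 + u ^+ 2 * e%:R in
  (val_k = val theta1 \/ val_k = val theta3) /\
  (val_m = val theta1 \/ val_m = val theta3).
Proof.
move=> ev1 ev2 ev3 lt1 lt2 lt3 q0 s2 sE val val_k val_m.
have [t2 _ _ /andP[t3 t1]] := adjacency_spectrum ev1 ev2 ev3 lt1 lt2 lt3.
have kin : val_k \in s by rewrite -sE qdistance_eigenvalue_valency.
have neqk t : t < theta1 \/ t = theta1 -> t != k%:R.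
  by case=> [lt|->]; rewrite lt_eqF // (lt_trans lt).
have in1 : val theta1 \in s.
  rewrite -sE; have := qdistance_eigenvalue q ev1 (neqk _ (or_intror erefl)).
  by rewrite gt_eqF.
have in3 : val theta3 \in s.
  rewrite -sE.
  have := qdistance_eigenvalue q ev3 (neqk _ (or_introl (lt_trans lt3 lt2))).
  by rewrite lt_eqF.
have inm : val_m \in s.
  rewrite -sE; have := qdistance_eigenvalue q ev2 (neqk _ (or_introl lt2)).
  by rewrite t2 eqxx.
have u0 : u != 0 by rewrite invr_eq0.
have n13 : val theta1 != val theta3.
  apply: contraNneq u0 => v13.
  have : u * (theta1 - theta3) == 0 by apply/eqP; rewrite /val in v13; lra.
  by rewrite mulf_eq0 subr_eq0 (gt_eqF (lt_trans t3 t1)) orbF.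
case: s s2 {sE} kin in1 in3 inm => [|x [|y []]] // _.
rewrite !inE => /orP kin /orP in1 /orP in3 /orP inm; move: n13.
case: in1 => /eqP E1; case: in3 => /eqP E3; rewrite E1 E3 ?eqxx // => _.
all: by split; [case: kin | case: inm] => /eqP ->; rewrite ?E1 ?E3; tauto.
Qed.

End DistanceMatrices.

(** * Feasible parameters *)

(** In lowest terms the denominator divides the square of the numerator. *)
Lemma rational_quadratic_integer (R : numFieldType) (x : R) (p q d k : int) :
  q != 0 -> x * q%:~R = p%:~R -> x ^+ 2 = d%:~R * x + k%:~R ->
  exists t : int, x = t%:~R.
Proof.
move=> q0 xE x2; pose y : rat := p%:~R / q%:~R.
have qR : q%:~R != 0 :> R by rewrite intr_eq0.
have qQ : q%:~R != 0 :> rat by rewrite intr_eq0.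
have pE : p ^+ 2 = d * p * q + k * q ^+ 2.
  apply: (@intr_inj R); rewrite !(rmorphXn, rmorphD, rmorphM) /= -xE.
  by rewrite exprMn x2; ring.
have y2 : y ^+ 2 = d%:~R * y + k%:~R.
  have /(congr1 (intr : int -> rat)) := pE.
  rewrite !(rmorphXn, rmorphD, rmorphM) /= => pQ.
  by rewrite /y expr_div_n pQ; field.
have n2 : numq y ^+ 2 = denq y * (d * numq y + k * denq y).
  apply: (@intr_inj rat); rewrite !(rmorphXn, rmorphD, rmorphM) /= numqE.
  by rewrite exprMn y2; ring.
have den1 : `|denq y|%N == 1%N.
  have dvd : (`|denq y| %| `|numq y| ^ 2)%N by rewrite -abszX n2 abszM dvdn_mulr.
  have : coprime `|denq y| `|denq y|.
    by apply: coprime_dvdl dvd _; rewrite coprimeXl // coprime_num_den.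
  by rewrite /coprime gcdnn.
exists (numq y); have denE : denq y = 1.
  by rewrite -[denq y]gez0_abs ?denq_ge0 // (eqP den1).
have yE : y * q%:~R = p%:~R by rewrite /y divfK.
apply: (mulIf qR); rewrite xE; have := numqE y.
rewrite denE mulr1 => yn; rewrite -{1}yn in yE.
by move: yE; rewrite -!intrM => /intr_inj <-; rewrite intrM.
Qed.

(** Here e + 1 is the size of an antipodal class, t = theta1 and m = - theta3. As m
   is at least 2, the factor D of m is at most half of the right-hand side N; as D
   is negative for t <= e + 1, only finitely many e and t remain. *)
Lemma feasible_integers (e t m : int) :
  0 < e -> 0 < t -> 1 < m ->
  m * (e * t ^+ 2 - (e ^+ 2 + e + 2) * t - 1) =
    t ^+ 2 + (1 - e) * t + (e ^+ 2 + e + 1) ->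
  (e, t, m) \in [:: (1, 5, 7); (2, 5, 3); (3, 5, 7)].
Proof.
move=> e0 t0 m1 mE.
have [D DE] : exists D, D = e * t ^+ 2 - (e ^+ 2 + e + 2) * t - 1 by eexists.
have [N NE] : exists N, N = t ^+ 2 + (1 - e) * t + (e ^+ 2 + e + 1) by eexists.
rewrite -DE -NE in mE.
have N0 : 0 < N.
  have : 4 * N = (2 * t + 1 - e) ^+ 2 + 3 * (e + 1) ^+ 2 by rewrite NE; ring.
  have := sqr_ge0 (2 * t + 1 - e); have : 0 < (e + 1) ^+ 2 by rewrite exprn_gt0; lia.
  by move: (_ ^+ 2) (_ ^+ 2) => x y; lia.
have D0 : 0 < D by rewrite -(pmulr_rgt0 _ (x := m)) ?mE //; lia.
have ND : D <= N - D.
  have : 0 <= (m - 2) * D by rewrite mulr_ge0 //; lia.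
  by rewrite mulrBl mE; lia.
have te : e + 2 <= t.
  rewrite leNgt; apply/negP => te.
  have ef : 0 <= e * (e + 1 - t) by rewrite mulr_ge0 //; lia.
  have tf : 0 < t * (e * (e + 1 - t) + 2) by rewrite mulr_gt0 //; lia.
  have : D = - (t * (e * (e + 1 - t) + 2)) - 1 by rewrite DE; ring.
  by move: tf (t * _) D0 => tf x D0; lia.
have NDE : N - D = (t + 1) * (e ^+ 2 + e + 2 - (e - 1) * t).
  by rewrite NE DE; ring.
have f0 : 0 < e ^+ 2 + e + 2 - (e - 1) * t.
  by rewrite -(pmulr_rgt0 _ (x := t + 1)) -?NDE; lia.
have e5 : e <= 5.
  rewrite leNgt; apply/negP => e5.
  have tE : t = e + 2.
    apply/eqP; rewrite eq_le te andbT leNgt; apply/negP => te3.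
    have : 0 <= (e - 1) * (t - e - 3) by rewrite mulr_ge0 //; lia.
    have fE : e ^+ 2 + e + 2 - (e - 1) * t = 5 - e - (e - 1) * (t - e - 3) by ring.
    by rewrite fE in f0; move: f0; move: (_ * _) => x; lia.
  have {}DE : D = e ^+ 2 - 5 by rewrite DE tE; ring.
  have {}NDE : N - D = 4 * (e + 3) by rewrite NDE tE; ring.
  have e6 : e <= 6.
    rewrite leNgt; apply/negP => e6.
    have : 0 <= (e - 7) * (e + 3) by rewrite mulr_ge0 //; lia.
    have -> : (e - 7) * (e + 3) = e ^+ 2 - 4 * e - 21 by ring.
    by move: DE; move: (_ ^+ 2) => x; lia.
  have e6E : e = 6 by lia.
  by rewrite e6E in DE NDE; lia.
have t8 : t <= 8.
  rewrite leNgt; apply/negP => t8.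
  have [e1|e1] := eqVneq e 1.
    have : 0 <= (t - 9) * (t + 1) by rewrite mulr_ge0 //; lia.
    have -> : (t - 9) * (t + 1) = D - 4 * (t + 1) - 4 by rewrite DE e1; ring.
    by rewrite NDE e1 in ND; lia.
  have : 0 <= (e - 2) * (t - 9) by rewrite mulr_ge0 //; lia.
  have : 0 <= (e - 2) * (5 - e) by rewrite mulr_ge0 //; lia.
  have fE : e ^+ 2 + e + 2 - (e - 1) * t =
    10 - e - t - (e - 2) * (5 - e) - (e - 2) * (t - 9) by ring.
  by rewrite fE in f0; move: f0; move: (_ * _) (_ * _) => x y; lia.
have e_in : e \in [:: 1; 2; 3; 4; 5] by rewrite !inE; lia.
have t_in : t \in [:: 3; 4; 5; 6; 7; 8] by rewrite !inE; lia.
rewrite !inE !xpair_eqE; move: e_in t_in DE NE mE D0; rewrite !inE.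
do ![case/orP=> [/eqP->|] | move/eqP->].
all: move=> /= DE NE mE D0; lia.
Qed.

Section TwoValues.
Variables (R : realType) (k a1 b1 c2 e : nat) (theta1 theta3 u : R).
Hypotheses (kE : k = (a1 + b1).+1) (b1E : b1 = (e * c2)%N).
Hypotheses (c2_gt0 : (0 < c2)%N) (e_gt0 : (0 < e)%N).
Hypotheses (prodE : theta1 * theta3 = - k%:R).
Hypotheses (sumE : theta1 + theta3 = a1%:R - c2%:R).
Hypotheses (theta3_lt : theta3 < -1) (theta1_gt : -1 < theta1).

(* The q-distance eigenvalues at theta1 and theta3 are their images under val, and
   val_k and val_m are those at k and at -1. *)
Let K : R := k%:R.
Let E : R := e%:R.
Let val t : R := - u * t - (1 + u + u ^+ 2).
Let val_k : R := K + (1 + u) * (E * K) + (1 + u + u ^+ 2) * E.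
Let val_m : R := -1 + u ^+ 2 * E.

Let E1 : 1 <= E. Proof. by rewrite /E ler1n. Qed.
Let K1 : 1 <= K. Proof. by rewrite /K kE ler1n. Qed.

Let theta1_gt0 : 0 < theta1.
Proof.
have : 0 < theta1 * - theta3 by rewrite mulrN prodE opprK (lt_le_trans _ K1).
have t3 : 0 < - theta3 by have := theta3_lt; lra.
by rewrite pmulr_lgt0.
Qed.

Let quadratic : theta1 ^+ 2 = (a1%:Z - c2%:Z)%:~R * theta1 + (k%:Z)%:~R.
Proof. by rewrite rmorphB /= -!pmulrn -sumE; have := prodE; lra. Qed.

Lemma val_m_theta t : u != 0 -> val_m = val t -> (E + 1) * u = - (t + 1).
Proof.
move=> u0; rewrite /val_m /val => vE; apply: (mulfI u0); lra.
Qed.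

(** The equality would make u positive. Then val_k is positive and val theta1
   negative, while val theta3 < val_k follows from theta3 = - (E + 1) u - 1. *)
Lemma val_m_neq_theta3 : u != 0 -> val_k = val theta1 \/ val_k = val theta3 ->
  val_m != val theta3.
Proof.
have [[E1' K1'] [lt3 gt1 t1_gt0]] := conj (conj E1 K1) (And3 theta3_lt theta1_gt theta1_gt0).
move=> u0 vk; apply/eqP=> /(val_m_theta u0) uE.
have u_gt0 : 0 < u by rewrite -(pmulr_rgt0 _ (x := E + 1)); lra.
have uK : 0 < u * (E * K) by rewrite !mulr_gt0 //; lra.
have EK : 0 < E * K by apply: mulr_gt0; lra.
have u2 : 0 < u ^+ 2 by rewrite exprn_gt0.
have uu : 0 < u ^+ 2 * E by apply: mulr_gt0; lra.
have uE0 : 0 < u * E by apply: mulr_gt0; lra.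
have ut : 0 < u * theta1 by rewrite mulr_gt0.
case: vk; rewrite /val_k /val => vk; first by lra.
have ut3 : u * theta3 = - u - (E + 1) * u ^+ 2.
  have -> : theta3 = - (E + 1) * u - 1 by lra.
  ring.
have uEu : 0 <= u * (E * K - 1).
  apply: mulr_ge0; first exact: ltW.
  have : 0 <= (E - 1) * K by apply: mulr_ge0; lra.
  by lra.
by lra.
Qed.

(** Then (e + 1)^2 = e (theta1 + 1), so that e divides 1 as theta1 is an
   algebraic integer. *)
Lemma val_k_theta1 : val_k = val theta1 -> val_m = val theta1 -> u != 0 ->
  [/\ e = 1%N, u = -2, k = (3 * a1.-1)%N & theta1 = 3].
Proof.
have [[E1' K1'] [lt3 gt1 t1_gt0]] := conj (conj E1 K1) (And3 theta3_lt theta1_gt theta1_gt0).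
move=> vk vm u0; have uE := val_m_theta u0 vm.
have u1E : 1 + (1 + u) * E = 0.
  apply: (mulfI (x := K + 1)); first by rewrite gt_eqF //; lra.
  by rewrite mulr0 -(subrr (val theta1)) -{1}vk -vm /val_k /val_m; ring.
have tE : E * theta1 = E ^+ 2 + E + 1.
  have : E * (E + 1) * u = - (E * (theta1 + 1)) by rewrite -mulrA uE; ring.
  have -> : E * (E + 1) * u = (E + 1) * (E * u) by ring.
  have -> : E * u = - (E + 1) by lra.
  by lra.
have zE : ((e%:Z ^+ 2 + e%:Z + 1) ^+ 2 =
    (a1%:Z - c2%:Z) * e%:Z * (e%:Z ^+ 2 + e%:Z + 1) + k%:Z * e%:Z ^+ 2)%R.
  apply: (@intr_inj R); rewrite !(rmorphXn, rmorphD, rmorphM) /=.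
  rewrite -!pmulrn -/E -tE; rewrite exprMn quadratic; rewrite -!pmulrn; ring.
have e1 : e = 1%N.
  have : e%:Z * ((a1%:Z - c2%:Z) * (e%:Z ^+ 2 + e%:Z + 1) + k%:Z * e%:Z
    - (e%:Z + 1) * (e%:Z ^+ 2 + e%:Z + 2)) = 1.
    transitivity ((e%:Z ^+ 2 + e%:Z + 1) ^+ 2 - e%:Z * (e%:Z + 1) * (e%:Z ^+ 2 + e%:Z + 2)).
      by rewrite zE; ring.
    ring.
  move: (_ + _ - _) => z ez.
  have z0 : 0 < z by rewrite -(pmulr_rgt0 _ (x := e%:Z)) ?ez //; lia.
  have : 0 <= e%:Z * (z - 1) by apply: mulr_ge0; lia.
  by rewrite mulrBr ez; lia.
have Ee : E = 1 by rewrite /E e1.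
rewrite Ee in uE tE u1E; have t3 : theta1 = 3 by lra.
split=> //; first by lra.
have : 9 = (a1%:Z - c2%:Z) * 3 + k%:Z.
  by apply: (@intr_inj R); have := quadratic; rewrite t3 !(rmorphD, rmorphM) /=; lra.
by have := b1E; rewrite e1; lia.
Qed.

(** Modulo the quadratic equation of theta1 the condition is linear in theta1,
   which is therefore rational. *)
Lemma val_k_theta3 : val_k = val theta3 -> val_m = val theta1 -> u != 0 ->
  [\/ [/\ e = 1%N, u = -3, [/\ k = 35, a1 = 16 & c2 = 18]%N, theta1 = 5 &
          theta3 = -7],
      [/\ e = 2, k = 15, a1 = 6 & c2 = 4]%N |
      [/\ e = 3, k = 35, a1 = 7 & c2 = 9]%N].
Proof.
have [[E1' K1'] [lt3 gt1 t1_gt0]] := conj (conj E1 K1) (And3 theta3_lt theta1_gt theta1_gt0).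
move=> vk vm u0; have uE := val_m_theta u0 vm.
pose d : int := a1%:Z - c2%:Z.
pose D : R := d%:~R.
have sD : theta1 + theta3 = D by rewrite sumE /D /d rmorphB /= -!pmulrn.
have qE : theta1 ^+ 2 = D * theta1 + K by rewrite quadratic /K -pmulrn.
have lin : theta1 * (E * K + E - 2 - D) =
    K * (E ^+ 2 + E + 3) + E ^+ 2 + E + 1 - D.
  have : (E + 1) ^+ 2 * (val_k - val theta3) = 0 by rewrite vk subrr mulr0.
  rewrite /val_k /val (_ : theta3 = D - theta1); last by lra.
  have -> : (E + 1) ^+ 2 * (K + (1 + u) * (E * K) + (1 + u + u ^+ 2) * E
     - (- u * (D - theta1) - (1 + u + u ^+ 2))) =
    (E + 1) ^+ 2 * K + ((E + 1) ^+ 2 + (E + 1) * ((E + 1) * u)) * (E * K)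
    + (E + 1) * ((E + 1) ^+ 2 + (E + 1) * ((E + 1) * u) + ((E + 1) * u) ^+ 2)
    + (E + 1) * ((E + 1) * u) * (D - theta1) by ring.
  rewrite uE => h; apply: (mulfI (x := E + 1)); first by rewrite gt_eqF //; lra.
  have q2 : (E + 1) * theta1 ^+ 2 = (E + 1) * (D * theta1 + K) by rewrite qE.
  by lra.
have DE : D = a1%:R - c2%:R by rewrite /D /d rmorphB /= -!pmulrn.
have [t tE] : exists t : int, theta1 = t%:~R.
  pose q : int := e%:Z * k%:Z + e%:Z - 2 - d.
  pose p : int := k%:Z * (e%:Z ^+ 2 + e%:Z + 3) + e%:Z ^+ 2 + e%:Z + 1 - d.
  have pE : theta1 * q%:~R = p%:~R.
    rewrite !(rmorphXn, rmorphB, rmorphD, rmorphM) /= -!pmulrn.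
    by have := lin; rewrite DE /E /K; lra.
  apply: (rational_quadratic_integer _ pE quadratic).
  have p0 : 0 < p.
    have : 0 <= k%:Z * (e%:Z ^+ 2 + e%:Z) by rewrite mulr_ge0 // addr_ge0 // exprn_ge0.
    have : 0 <= e%:Z ^+ 2 by rewrite exprn_ge0.
    rewrite /p /d mulrDr; move: (_ ^+ 2) (_ * _) => x y; rewrite kE; lia.
  apply: contraTneq p0 => q0; rewrite -leNgt.
  by move: pE; rewrite q0 mulr0 => /esym/eqP; rewrite intr_eq0 => /eqP->.
have [m mE] : exists m : int, m = t - d by eexists.
have t3 : theta3 = - m%:~R.
  by rewrite mE rmorphB /= -tE -/D -sD; ring.
have kmt : k%:Z = t * m.
  apply: (@intr_inj R); rewrite rmorphM /= -tE -pmulrn -[m%:~R]opprK -t3.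
  by rewrite mulrN prodE opprK.
have t0 : 0 < t by rewrite -(ltr0z R) -tE.
have cE : (e%:Z + 1) * c2%:Z = (t + 1) * (m - 1).
  have -> : (t + 1) * (m - 1) = t * m - d - 1 by rewrite mE; ring.
  by rewrite -kmt /d; have := b1E; have := kE; nia.
have m1 : 1 < m.
  have : 0 < (t + 1) * (m - 1) by rewrite -cE mulr_gt0 //; lia.
  by rewrite pmulr_rgt0; lia.
have := @feasible_integers e t m; rewrite t0 m1 => /(_ _ isT isT) feas.
have {feas} : (e%:Z, t, m) \in [:: (1, 5, 7); (2, 5, 3); (3, 5, 7)].
  apply: feas; first lia.
  apply: (@intr_inj R).
  rewrite !(rmorphXn, rmorphB, rmorphD, rmorphM) /= -!pmulrn -tE -/E.
  have mR : m%:~R = theta1 - D :> R by rewrite mE rmorphB /= -tE.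
  have tm : theta1 * m%:~R = K by rewrite tE -rmorphM /= -kmt /K -pmulrn.
  rewrite -{}tm in lin; move: (m%:~R) mR lin => x xE; rewrite (_ : D = theta1 - x).
    by lra.
  by rewrite xE; ring.
rewrite !inE !xpair_eqE => cases.
case/or3P: cases => /andP[/andP[/eqP eE /eqP tE'] /eqP mE'];
  rewrite /d tE' mE' in mE kmt cE; [apply: Or31|apply: Or32|apply: Or33].
- have e1 : e = 1%N by lia.
  have EE : E = 1 by rewrite /E e1.
  split=> //; [|split; lia|by rewrite tE tE'|by rewrite t3 mE'].
  by move: uE; rewrite EE tE tE' /=; lra.
- by split; lia.
- by split; lia.
Qed.

End TwoValues.

(** * Two infeasible arrays *)

(** Exchanging its ends maps the ordered edges with increasing rank onto those with
   decreasing rank. *)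
Lemma handshake (T : finType) (r : rel T) (S : {set T}) :
  symmetric r -> irreflexive r ->
  ~~ odd (\sum_(x in S) #|[set y in S | r x y]|).
Proof.
move=> r_sym r_irr.
pose F (x y : T) : nat := [&& x \in S, y \in S & r x y].
pose L (x y : T) : bool := (enum_rank x < enum_rank y)%N.
have -> : (\sum_(x in S) #|[set y in S | r x y]|
    = \sum_x \sum_(y | L x y) F x y + \sum_x \sum_(y | L x y) F x y)%N.
  rewrite [X in (_ = _ + X)%N](exchange_big_dep xpredT) //= -big_split big_mkcond /=.
  apply: eq_bigr => x _.
  have -> : (if x \in S then #|[set y in S | r x y]| else 0%N) = (\sum_y F x y)%N.
    rewrite /F; case: (x \in S) => /=; last by rewrite big1.
    by rewrite -sum1dep_card big_mkcond /=; apply: eq_bigr => y _; case: (_ && _).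
  rewrite (bigID (L x)) /=; congr (_ + _)%N.
  rewrite big_mkcond [RHS]big_mkcond; apply: eq_bigr => y _.
  rewrite /L -leqNgt leq_eqVlt /F r_sym.
  have [/val_inj/enum_rank_inj->|_] := eqVneq (val (enum_rank y)) _.
    by rewrite ltnn r_irr !andbF.
  by rewrite /=; case: ifP => //; rewrite andbCA.
by rewrite addnn odd_double.
Qed.

(** For a full rank factorization F = C R the hypothesis gives R C = c, and F has
   the same trace as R C. *)
Lemma mxrank_quasi_idempotent (K : fieldType) n (F : 'M[K]_n) (c : K) :
  c != 0 -> F *m F = c *: F -> (\rank F)%:R * c = \tr F.
Proof.
move=> c0 FF; have FE := mulmx_base F.
have RC : row_base F *m col_base F = c%:M.
  apply: (row_full_inj (col_base_full F)); apply: (row_free_inj (row_base_free F)).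
  by rewrite /= mulmxA FE -mulmxA FE FF mul_mx_scalar -scalemxAl FE.
by rewrite -[in RHS]FE mxtrace_mulC RC mxtrace_scalar mulr_natl.
Qed.

Section Excluded.
Variables (R : realType) (G : sgraph) (a b c : nat -> nat).
Hypotheses (hG : distance_regular G a b c) (hD : diameter G = 3%N).
Hypotheses (b2 : b 2%N = 1%N) (c3 : c 3%N = b 0%N).

Let conn : connected G := hG.1.

Let local_valency (x y : G) : adj x y ->
  #|[set z in [set z | adj x z] | adj y z]| = a 1%N.
Proof.
rewrite -(gdist_eq1 conn) => /eqP d; rewrite -(card_same hG d).
by apply: eq_card => z; rewrite !inE gdist_eq1 // andbC.
Qed.

(** The subgraph induced on the b 0 neighbours of a vertex has valency a 1. *)
Lemma valency_a1_even : ~~ odd (b 0%N * a 1%N)%N.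
Proof.
have [x _] := ex_gdist3 hD.
rewrite -(valency hG x) -sum_nat_const.
rewrite -(eq_bigr _ (F1 := fun y => #|[set z in [set z | adj x z] | adj y z]|)).
  by apply: handshake; [exact: adj_sym|exact: adj_irr].
by move=> y; rewrite inE => /local_valency.
Qed.

(** F is 24 times the projection on the eigenspace of 5, and has rank 12. Let A' be
   the adjacency matrix of the graph induced on the 15 neighbours of x. On these
   F restricts to B = 7 + 3 A' - J, which is therefore singular. A vector v with
   v B = 0 is orthogonal to the all-ones vector, since A' has constant row sums,
   and so v (7 + 3 A') = 0. But the determinant of 7 + 3 A' is 1 modulo 3. *)
Lemma array_15_8_1_excluded (card3 : forall x : G, #|sphere 3 x| = 2%N) :
  b 0%N = 15%N -> a 1%N = 6%N -> c 2%N = 4%N -> False.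
Proof.
move=> k a1 c2; pose A := adjacency_mx R G.
pose A2 := dist_mx R G 2; pose A3 := dist_mx R G 3.
have b1 : b 1%N = 8%N by have := a1E hG hD; rewrite k a1 => -[].
have a2 : a 2%N = 10%N by have := a2E hG hD b2 c3; rewrite k c2; lia.
have [x _] := ex_gdist3 hD.
have cG : #|G| = 48%N.
  by rewrite (card_spheres hG hD x) k (card_sphere2 hG b2 c3) card3 k.
have AA : A *m A = 15%:R%:M + 6%:R *: A + 4%:R *: A2.
  by rewrite (adjacency_sqr R hG hD) k a1 c2.
have A2A : A2 *m A = 8%:R *: A + 10%:R *: A2 + 15%:R *: A3.
  by rewrite (dist2_mul_adjacency R hG hD c3) b1 a2 k.
have A3A : A3 *m A = A2 by rewrite (dist3_mul_adjacency R hG hD b2 c3).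
have [F FE] : exists F : 'M[R]_#|G|, F = 6 *: 1%:M + 2 *: A - A2 - 3 *: A3.
  by eexists.
have FA : F *m A = 5 *: F.
  rewrite FE !mulmxBl mulmxDl -!scalemxAl mul1mx AA A2A A3A -scalemx1.
  by apply/matrixP=> i j; rewrite !mxE; ring.
have FA2 : F *m A2 = -5 *: F.
  have : F *m (A *m A) = 25 *: F by rewrite mulmxA FA -scalemxAl FA scalerA; congr (_ *: _); ring.
  rewrite AA !mulmxDr mul_mx_scalar -!scalemxAr FA.
  move: (F *m A2) => X /matrixP h; apply/matrixP=> i j.
  by have := h i j; rewrite !mxE; lra.
have FA3 : F *m A3 = -1 *: F.
  have := congr1 (mulmx F) A2A.
  rewrite mulmxA FA2 -scalemxAl FA !mulmxDr -!scalemxAr FA FA2.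
  move: (F *m A3) => X /matrixP h; apply/matrixP=> i j.
  by have := h i j; rewrite !mxE; lra.
have FF : F *m F = 24 *: F.
  rewrite {2}FE !mulmxDr !mulmxN -!scalemxAr mulmx1 FA FA2 FA3.
  by apply/matrixP=> i j; rewrite !mxE; ring.
have trF : \tr F = 288.
  rewrite /mxtrace (eq_bigr (fun=> 6)) => [|i _]; last first.
    by rewrite FE !mxE !gdistxx eqxx adj_irr /=; ring.
  by rewrite sumr_const card_ord cG -mulrnA; ring.
have rF : \rank F = 12%N.
  have := mxrank_quasi_idempotent _ FF; rewrite trF => h.
  have {}h : (\rank F)%:R = 12%:R :> R.
    by have := h _; lra.
  by apply/eqP; rewrite -(eqr_nat R) h.
pose S := [set y | adj x y].
have cS : #|S| = 15%N by rewrite (valency hG) k.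
pose f (i : 'I_#|S|) := enum_rank (enum_val i).
pose B := mxsub f f F.
pose Cz : 'M[int]_#|S| :=
  \matrix_(i, j) (7 * (i == j)%:R + 3 * (adj (enum_val i) (enum_val j))%:R).
pose C : 'M[R]_#|S| := map_mx intr Cz.
have memS (i : 'I_#|S|) : adj x (enum_val i) by move: (enum_valP i); rewrite /S !inE.
have CE : C = B + const_mx 1.
  apply/matrixP=> i j; rewrite !mxE FE !mxE /f !enum_rankK.
  rewrite -gdist_eq1 // rmorphD !rmorphM /= !rmorph_nat.
  rewrite (inj_eq enum_rank_inj) (inj_eq enum_val_inj).
  have [->|ij] := eqVneq i j; first by rewrite gdistxx /=; ring.
  have : (gdist (enum_val i) (enum_val j) <= 2)%N.
    apply/gdist_le; apply: (walk_adj _ (memS j)).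
    by rewrite walk1 adj_sym.
  have : gdist (enum_val i) (enum_val j) != 0%N.
    by rewrite gdist_eq0 // (inj_eq enum_val_inj).
  by case: gdist => [|[|[|]]] //= _ _; ring.
have rB : (\rank B < #|S|)%N.
  apply: (@leq_ltn_trans 12); last by rewrite cS.
  rewrite -rF /B mxsubrc -[F in colsub f F]mulmx1.
  rewrite -mulmx_colsub -[X in rowsub f X]mul1mx -mul_rowsub_mx.
  by apply: leq_trans (mxrankM_maxr _ _) (mxrankM_maxl _ _).
have [v v0 vB] : exists2 v : 'rV_#|S|, v != 0 & v *m B = 0.
  have : kermx B != 0 by rewrite kermx_eq0 /row_free neq_ltn rB.
  by case/rowV0Pn=> v /sub_kermxP vB v0; exists v.
pose one : 'cV[R]_#|S| := const_mx 1.
have C1 : C *m one = 25 *: one.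
  apply/colP=> i; rewrite !mxE.
  transitivity (7 * 1 + 3 * (a 1%N)%:R : R); last by rewrite a1; ring.
  rewrite -(local_valency (memS i)).
  rewrite (eq_bigr (fun j => 7 * (i == j)%:R +
      3 * (enum_val j \in [set z | adj (enum_val i) z])%:R)) => [|j _]; last first.
    by rewrite !mxE mulr1 inE rmorphD !rmorphM /= !rmorph_nat.
  rewrite big_split -!mulr_sumr /=; congr (7 * _ + 3 * _).
    by rewrite (bigD1 i) //= eqxx big1 ?addr0 // => j /negPf; rewrite eq_sym => ->.
  transitivity (\sum_(z in S) (z \in [set z | adj (enum_val i) z])%:R : R).
    by rewrite [RHS](big_enum_val (A := mem S)).
  rewrite -sum1_card natr_sum [LHS]big_mkcond [RHS]big_mkcond /=.
  by apply: eq_bigr => z _; rewrite !inE; do !case: adj.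
have J1 : v *m const_mx 1 *m one = 15 *: (v *m one).
  rewrite -mulmxA (_ : const_mx 1 *m one = 15 *: one) -?scalemxAr //.
  apply/colP=> i; rewrite !mxE mulr1 (eq_bigr (fun=> 1)) => [|j _].
    by rewrite sumr_const card_ord cS.
  by rewrite !mxE mulr1.
have vC : v *m C = v *m const_mx 1 by rewrite CE mulmxDr vB add0r.
have v1 : v *m one = 0.
  have : 10 *: (v *m one) = 0.
    have -> : 10 = 25 - 15 :> R by ring.
    rewrite scalerBl -J1 -vC -mulmxA C1 -scalemxAr subrr //.
  by move/eqP; rewrite scaler_eq0 pnatr_eq0 => /eqP.
have vC0 : v *m C = 0.
  rewrite vC; apply/rowP=> j.
  transitivity ((v *m one) 0 0); last by rewrite v1 !mxE.
  by rewrite !mxE; apply: eq_bigr => i _; rewrite !mxE.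
case/negP: v0; apply/eqP.
suff CU : C \in unitmx by rewrite -[v](mulmxK CU) vC0 mul0mx.
rewrite unitmxE unitfE det_map_mx intr_eq0.
apply/eqP=> d0.
have : \det (map_mx (intr : int -> 'F_3) Cz) = 0 by rewrite det_map_mx d0.
have -> : map_mx (intr : int -> 'F_3) Cz = 1%:M.
  apply/matrixP=> i j; rewrite !mxE rmorphD !rmorphM /= !rmorph_nat.
  have -> : 7%:R = 1 :> 'F_3 by apply/val_inj.
  have -> : 3%:R = 0 :> 'F_3 by apply/val_inj.
  by rewrite mul1r mul0r addr0.
by rewrite det1 => /eqP; rewrite oner_eq0.
Qed.

End Excluded.

(** * The q-distance polynomial *)

Lemma poly_mx_cubic (R : realType) n (A : 'M[R]_n) (p0 p1 p2 p3 : R) :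
  poly_mx (Poly [:: p0; p1; p2; p3]) A =
    p0%:M + p1 *: A + p2 *: (A *m A) + p3 *: (A *m A *m A).
Proof.
set p := Poly _; have sp : (size p <= 4)%N := size_Poly _.
rewrite /poly_mx (big_ord_widen 4 (fun i => p`_i *: A ^+ i)) // big_mkcond /=.
rewrite (eq_bigr (fun i : 'I_4 => p`_i *: A ^+ i)) => [|i _]; last first.
  by case: ltnP => // /leq_sizeP/(_ i (leqnn _)) ->; rewrite scale0r.
rewrite !big_ord_recr big_ord0 /= add0r !coef_Poly /=.
by rewrite expr0 expr1 expr2 !exprS expr0 mulr1 scalemx1 !mulmxE -mulrA.
Qed.

Section Polynomial.
Variables (R : realType) (G : sgraph) (a b c : nat -> nat).
Hypotheses (hG : distance_regular G a b c) (hD : diameter G = 3%N).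
Hypotheses (b2 : b 2%N = 1%N) (c3 : c 3%N = b 0%N).

(** The value at t of the polynomial which expresses A2 in terms of A. *)
Definition dist2_value (k a1 c2 t : R) : R := (t ^+ 2 - a1 * t - k) / c2.

(** The same for the q-distance matrix A + (1 + u) A2 + (1 + u + u^2) A3, with the
   polynomial for A3 obtained from A2 A = b1 A + a2 A2 + k A3. *)
Definition qdistance_value (k a1 b1 c2 a2 u t : R) : R :=
  t + (1 + u) * dist2_value k a1 c2 t + (1 + u + u ^+ 2) *
    ((t * dist2_value k a1 c2 t - b1 * t - a2 * dist2_value k a1 c2 t) / k).

Lemma qdistance_polynomial (q : R) : exists2 p : {poly R}, qdistance_poly G q p &
  forall t, p.[t] = qdistance_value (b 0%N)%:R (a 1%N)%:R (b 1%N)%:R (c 2%N)%:R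
                      (a 2%N)%:R q^-1 t.
Proof.
set k : R := (b 0%N)%:R; set a1 : R := (a 1%N)%:R; set b1 : R := (b 1%N)%:R.
set C : R := (c 2%N)%:R; set a2 : R := (a 2%N)%:R; set u := q^-1.
have k0 : k != 0 by rewrite pnatr_eq0 -lt0n (valency_gt0 hG hD).
have C0 : C != 0 by rewrite pnatr_eq0 -lt0n (c2_gt0 hG hD).
pose w := 1 + u; pose z := 1 + u + u ^+ 2.
exists (Poly [:: - w * k / C + z * a2 / C;
  1 - w * a1 / C - z * (C^-1 + b1 / k - a2 * a1 / (C * k));
  w / C - z * (a1 + a2) / (C * k); z / (C * k)]).
  split; first by rewrite hD size_Poly.
  rewrite poly_mx_cubic (qdistance_mxE hG hD) -/u -/w -/z.
  rewrite (adjacency_sqr R hG hD) !mulmxDl mul_scalar_mx -!scalemxAl.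
  rewrite (adjacency_sqr R hG hD) (dist2_mul_adjacency R hG hD c3) -/k -/a1 -/b1 -/C -/a2.
  apply/matrixP=> i j; rewrite !mxE.
  move: (i == j) (_ == 2)%:R (_ == 3)%:R (adj _ _)%:R => d d2 d3 d1.
  case: d; rewrite ?mulr1n ?mulr0n.
    by field; rewrite k0 C0.
  by field; rewrite k0 C0.
move=> t; rewrite horner_Poly /= /qdistance_value /dist2_value -/w -/z.
by field; rewrite k0 C0.
Qed.

End Polynomial.

(** * The Gosset graph and the classification *)

Lemma taylor_distance2K (G : sgraph) (s : G -> G) (k a1 : nat) :
  taylor s k a1 -> (0 < a1 < k.-1)%N ->
  isomorphic (distance2_graph (distance2_graph G)) G.
Proof.
move=> tG /andP[a1_gt0 a1_lt]; exists (fun x => x); first by exists id.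
have tG2 := taylor_distance2 tG a1_lt.
move=> x y; rewrite (adj_distance2 tG2); last lia.
by rewrite (adj_distance2 tG a1_lt) (antipodeK tG).
Qed.

(** Passing to distance-2 graphs exchanges the array of G with that of the Gosset
   graph, and the coordinates of G make it the only graph with its array. *)
Lemma distance2_is_gosset (G : sgraph) (s : G -> G) (phi : code -> G) :
  G -> taylor s 27 10 -> framing code_adj (codes 5) phi ->
  is_gosset (distance2_graph G).
Proof.
move=> o tG phiE; have tG2 := taylor_distance2 tG (isT : 10 < 26)%N.
split; first exact: (taylor_array tG2 isT o).
  by rewrite (card_taylor tG2 o).
move=> H [a [b [c [hH bE cE]]]].
have hD : diameter H = 3%N by have := congr1 size bE; rewrite size_map size_iota.
move: bE cE; rewrite hD /= => -[b0 b1 b2] [c1 c2 c3].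
have c3' : c 3%N = b 0%N by rewrite -c3 -b0.
have b1' : b 1%N = c 2%N by rewrite -b1 -c2.
have [s' tH] := distance_regular_taylor hH hD (esym b2) c3' b1'.
have a1E : a 1%N = 16%N by have := a1E hH hD; rewrite -b0 -b1; lia.
rewrite -b0 a1E in tH; have tH2 := taylor_distance2 tH (isT : 16 < 26)%N.
have [x0 _] := ex_gdist3 hD.
apply: (isomorphic_trans (isomorphic_sym (taylor_distance2K tH isT))).
apply: isomorphic_distance2.
apply: (@taylor_framed_isomorphic (distance2_graph H) s' 27 10 G phi x0 tH2) => //.
by rewrite (card_taylor tG o).
Qed.

Theorem proposition3p9 (R : realType) (G : sgraph) (a b c : nat -> nat)
    (k : nat) (theta1 theta2 theta3 q : R)
    (hG : distance_regular G a b c)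
    (hD : diameter G = 3%N)
    (hanti : antipodal G)
    (hk : k = b 0%N)
    (hA : distinct_eigenvalues (adjacency_mx R G)
            [:: k%:R; theta1; theta2; theta3])
    (h1 : theta1 < k%:R) (h2 : theta2 < theta1) (h3 : theta3 < theta2)
    (hq : q != 0)
    (hDq : exists2 s : seq R,
             size s = 2%N & distinct_eigenvalues (qdistance_mx G q) s) :
  exists2 Rq : {poly R}, qdistance_poly G q Rq &
  [\/ [/\ isomorphic G (johnson 6 3),
          has_intersection_array G [:: 9; 4; 1]%N [:: 1; 4; 9]%N,
          q = - (1 / 2) &
          [/\ Rq.[k%:R] = 3, Rq.[3] = 3 & Rq.[-1] = 3]],
      [/\ isomorphic G (distance2_graph (halved_cube 6)),
          has_intersection_array G [:: 15; 8; 1]%N [:: 1; 8; 15]%N,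
          q = - (1 / 2) &
          [/\ Rq.[k%:R] = 3, Rq.[3] = 3 & Rq.[-1] = 3]],
      [/\ exists2 H : sgraph, is_gosset H & isomorphic G (distance2_graph H),
          has_intersection_array G [:: 27; 16; 1]%N [:: 1; 16; 27]%N,
          q = - (1 / 2) &
          [/\ Rq.[k%:R] = 3, Rq.[3] = 3 & Rq.[-1] = 3]] |
      [/\ has_intersection_array G [:: 35; 18; 1]%N [:: 1; 18; 35]%N,
          q = - (1 / 3) &
          [/\ Rq.[k%:R] = -28, Rq.[theta3] = -28,
              Rq.[theta1] = 8 & Rq.[-1] = 8]]].
Proof.
subst k; set k := b 0%N in hA h1 *.
have b2 := antipodal_b2 hG hD hanti; have c3 := antipodal_c3 hG hD hanti.
have c1 := c1E hG hD; have c2_gt0 := c2_gt0 hG hD.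
have [x0 [y0 d3]] := ex_gdist3 hD.
(* The antipodal classes have e + 1 vertices. *)
have b1E := b1E hG hD b2 c3; pose e := #|sphere 3 x0|.
have b1E' : b 1%N = (e * c 2%N)%N by rewrite (b1E x0).
have card3 (x : G) : #|sphere 3 x| = e.
  by apply/eqP; rewrite -(eqn_pmul2r c2_gt0) -!b1E.
have e_gt0 : (0 < e)%N by apply/card_gt0P; exists y0; rewrite inE d3.
have kE := esym (a1E hG hD); have a2E := a2E hG hD b2 c3.
have [Rq RqP RqE] := qdistance_polynomial hG hD c3 q.
exists Rq => //.
have ev t : t \in [:: k%:R; theta1; theta2; theta3] ->
    eigenvalue (adjacency_mx R G) t by rewrite -hA.2.
have ev1 : eigenvalue (adjacency_mx R G) theta1 by rewrite ev // !inE eqxx orbT.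
have ev2 : eigenvalue (adjacency_mx R G) theta2 by rewrite ev // !inE eqxx !orbT.
have ev3 : eigenvalue (adjacency_mx R G) theta3 by rewrite ev // !inE eqxx !orbT.
have [_ prodE sumE /andP[t3 t1]] :=
  adjacency_spectrum hG hD b2 c3 card3 ev1 ev2 ev3 h1 h2 h3.
have [s s2 [_ sE]] := hDq.
have [vk vm] :=
  two_qdistance_eigenvalues hG hD b2 c3 card3 ev1 ev2 ev3 h1 h2 h3 hq s2 sE.
have u0 : q^-1 != 0 by rewrite invr_eq0.
have qE v : q^-1 = - v -> q = - (1 / v).
  by move=> uE; rewrite -[q]invrK uE invrN div1r.
have array b0 b1 c2 : b 0%N = b0 -> b 1%N = b1 -> c 2%N = c2 ->
    has_intersection_array G [:: b0; b1; 1]%N [:: 1; c2; b0]%N.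
  move=> <- <- <-; exists a, b, c; rewrite hD /= b2 c1 c3; split=> //.
have vm1 : -1 + q^-1 ^+ 2 * e%:R = - q^-1 * theta1 - (1 + q^-1 + q^-1 ^+ 2).
  case: vm => // vm; have /eqP[] := val_m_neq_theta3 kE e_gt0 prodE t3 t1 u0 vk.
  exact: vm.
case: vk => vk; last first.
  have := val_k_theta3 kE b1E' c2_gt0 e_gt0 prodE sumE t3 t1 vk vm1 u0.
  case=> [[e1 /qE qE' [k35 a16 c18] t15 t37]|[e2 k15 a6 c4]|[e3 k35 a7 c9]].
  - have b18 : b 1%N = 18%N by rewrite b1E' e1 c18.
    apply: Or44; split; [exact: array|exact: qE'|].
    have a2 : a 2%N = 16%N by clear -a2E k35 c18; lia.
    rewrite !RqE /qdistance_value /dist2_value t15 t37 /k k35 a16 b18 c18 a2.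
    rewrite qE' invrN invf_div divr1; split; lra.
  - by case: (array_15_8_1_excluded R hG hD b2 c3 _ k15 a6 c4) => x; rewrite card3.
  - by have := valency_a1_even hG hD; rewrite k35 a7.
have [e1 uE k3 t13] := val_k_theta1 kE b1E' c2_gt0 e_gt0 prodE sumE t3 t1 vk vm1 u0.
have [s' tG] : exists s' : G -> G, taylor s' (b 0%N) (a 1%N).
  by apply: (distance_regular_taylor hG hD b2 c3); rewrite b1E' e1 mul1n.
have a1_lt : (a 1%N < (b 0%N).-1)%N.
  by clear -kE b1E' c2_gt0 e1; rewrite e1 in b1E'; lia.
have [t [phi [t_in a1t phiE]]] := taylor_framing tG a1_lt k3 x0.
have qE' := qE _ uE.
have iso (H : sgraph) (psi : code -> H) : framing code_adj (codes t) psi ->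
    (#|H| <= 12 * t - 4)%N -> isomorphic G H.
  move=> psiE cH.
  by apply: (taylor_framed_isomorphic (phi := psi) x0 tG a1_lt k3);
    rewrite a1t doubleK.
have params v w d : t.*2 = v -> (3 * v.-1)%N = w -> (w.-1 - v)%N = d ->
    [/\ a 1 = v, b 0 = w, b 1 = d, c 2 = d & a 2 = v]%N.
  clear -a1t k3 kE a2E b1E' e1; rewrite e1 in b1E' *.
  by move=> vE wE dE; split; lia.
move: t_in; rewrite !inE => /or3P[]/eqP tE; rewrite {}tE in iso phiE params.
- have [a1E bE b1E2 c2E a2E'] := params 4%N 9%N 4%N erefl erefl erefl.
  apply: Or41; split; [| exact: array | exact: qE' |].
    have [psi psiE] := johnson_framing; apply: iso psiE _.
    by rewrite card_johnson.
  rewrite !RqE /qdistance_value /dist2_value /k bE a1E b1E2 c2E a2E' uE.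
  by split; lra.
- have [a1E bE b1E2 c2E a2E'] := params 6%N 15%N 8%N erefl erefl erefl.
  apply: Or42; split; [| exact: array | exact: qE' |].
    have [psi psiE] := distance2_halved_cube_framing; apply: iso psiE _.
    exact: card_halved_cube.
  rewrite !RqE /qdistance_value /dist2_value /k bE a1E b1E2 c2E a2E' uE.
  by split; lra.
- have [a1E bE b1E2 c2E a2E'] := params 10%N 27%N 16%N erefl erefl erefl.
  apply: Or43; split; [| exact: array | exact: qE' |].
    rewrite bE a1E in tG; exists (distance2_graph G).
      exact: distance2_is_gosset tG phiE.
    exact: isomorphic_sym (taylor_distance2K tG isT).
  rewrite !RqE /qdistance_value /dist2_value /k bE a1E b1E2 c2E a2E' uE.
  by split; lra.
Qed.
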